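(* Let $T>0$, $f_0,f_T$ smooth, $K_1,K_2\ge1$ integers, and let $A$ and $a_0,\dots,a_{K+1}$ be as defined in the context. A pre-minimum-input solution for the $L^1$ metric always exists. Moreover, let $\tilde v$ be the limit of the input sequence of any pre-minimum-input solution for the $L^1$ metric. If $\int_{-T}^T a_j(x)\,dx=A$ for some $j\in\{1,\dots,K\}$, then $\tilde v(x)=a_j(x)$ for almost every $x\in[-T,T]$. Otherwise, if $j\in\{0,\dots,K\}$ is the index with $\int_{-T}^T a_{j+1}(x)\,dx<A<\int_{-T}^T a_j(x)\,dx$, then $a_{j+1}(x)\le\tilde v(x)\le a_j(x)$ for almost every $x\in[-T,T]$.
   Context: TBVP: given smooth $f_0,f_T:\mathbb R\to\mathbb R$ and $T>0$, a solution is a function $u\in C^2([0,T]\times\mathbb R)$ with $u_{tt}-u_{xx}=0$, $u(0,x)=f_0(x)$, $u(T,x)=f_T(x)$. Its input is $v(x)=u_t(0,x)$; the set of all inputs is the input space. Metric: fix integers $K_1,K_2\ge 1$, put $K=K_1+K_2+1$; inputs are measured by the norm of $L^1[-(2K_1+1)T,(2K_2+1)T]$. A pre-minimum-input solution (PMS) is a sequence of solutions whose sequence of inputs converges, in $L^1[-(2K_1+1)T,(2K_2+1)T]$, to a function whose norm equals the infimum of the norms of all inputs. Constant: $A=2f_T(0)-f_0(T)-f_0(-T)$. Functions $t_i$ on $[-T,T]$, $i=1,\dots,K$: $t_1=0$; for $k=1,\dots,K_2$, $$t_{k+1}(x)=f_0'(x)+2\sum_{n=0}^{k-1}f_0'(x+(2k-2n)T)-2\sum_{n=0}^{k-1}f_T'(x+(2k-2n-1)T)-f_0'(x+2kT);$$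 for $k=1,\dots,K_1$, $$t_{k+K_2+1}(x)=f_0'(x)+2\sum_{n=0}^{k-1}f_T'(x+(2n+1-2k)T)-2\sum_{n=0}^{k-1}f_0'(x+2(n+1-k)T)-f_0'(x-2kT).$$ For $x\in[-T,T]$ let $a_1(x)\ge a_2(x)\ge\dots\ge a_K(x)$ be the values $t_1(x),\dots,t_K(x)$ arranged in decreasing order (with multiplicity); set $a_0=+\infty$, $a_{K+1}=-\infty$, with integrals $+\infty$ and $-\infty$ respectively. *)

(* Defs.v *)
From HB Require Import structures.
From mathcomp Require Import all_boot all_order all_algebra.
From mathcomp Require Import all_classical all_reals all_analysis.

Set Implicit Arguments.
Unset Strict Implicit.
Unset Printing Implicit Defensive.

Import Order.TTheory GRing.Theory Num.Theory.
Import numFieldNormedType.Exports.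

Local Open Scope classical_set_scope.
Local Open Scope ring_scope.

Definition smooth (R : realType) (f : R -> R) : Prop :=
  forall n x, derivable (derive1n n f) x 1.

(* A function of (t, x) is represented in curried form, [u t x]; only its
   values for t in [0, T] matter. The time derivative is taken inside [0, T],
   so it is one-sided at t = 0 and at t = T. *)
Definition time_quotient (R : realType) (u : R -> R -> R) (t x : R) : R -> R :=
  fun s => (u s x - u t x) / (s - t).

Definition dt (R : realType) (T : R) (u : R -> R -> R) : R -> R -> R :=
  fun t x => lim (time_quotient u t x @ within `[0, T] t^').

Definition dx (R : realType) (u : R -> R -> R) : R -> R -> R :=
  fun t x => derive1 (u t) x.

Definition strip_continuous (R : realType) (T : R) (u : R -> R -> R) : Prop :=
  {within [set p : R * R | 0 <= p.1 <= T],
    continuous (fun p : R * R => u p.1 p.2)}.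

Fixpoint strip_C (R : realType) (T : R) (k : nat) (u : R -> R -> R) : Prop :=
  strip_continuous T u /\
  (if k is k'.+1 then
     [/\ forall t x, 0 <= t <= T ->
           cvg (time_quotient u t x @ within `[0, T] t^'),
         forall t x, 0 <= t <= T -> derivable (u t) x 1,
         strip_C T k' (dt T u)
       & strip_C T k' (dx u)]
   else True).

Definition is_solution (R : realType) (T : R) (f0 fT : R -> R)
    (u : R -> R -> R) : Prop :=
  [/\ strip_C T 2 u,
      forall t x, 0 <= t <= T -> dt T (dt T u) t x - dx (dx u) t x = 0,
      forall x, u 0 x = f0 x
    & forall x, u T x = fT x].

Definition input (R : realType) (T : R) (u : R -> R -> R) : R -> R :=
  dt T u 0.

Definition input_space (R : realType) (T : R) (f0 fT : R -> R)
  : set (R -> R) :=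
  [set v | exists2 u, is_solution T f0 fT u & v = input T u].

Definition window (R : realType) (T : R) (K1 K2 : nat) : set R :=
  `[- ((2 * K1%:R + 1) * T), (2 * K2%:R + 1) * T].

Definition L1norm (R : realType) (D : set R) (v : R -> R) : \bar R :=
  (\int[@lebesgue_measure R]_(x in D) `|v x|%:E)%E.

Definition L1_cvg (R : realType) (D : set R) (w : nat -> R -> R)
    (v : R -> R) : Prop :=
  (@lebesgue_measure R).-integrable D (EFin \o v) /\
  (fun n => L1norm D (fun x => w n x - v x)) @ \oo --> 0%E.

Definition is_PMS (R : realType) (T : R) (f0 fT : R -> R) (K1 K2 : nat)
    (u : nat -> R -> R -> R) : Prop :=
  (forall n, is_solution T f0 fT (u n)) /\
  exists2 v : R -> R,
    L1_cvg (window T K1 K2) (fun n => input T (u n)) v &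
    L1norm (window T K1 K2) v =
      ereal_inf [set L1norm (window T K1 K2) w | w in input_space T f0 fT].

Definition constA (R : realType) (T : R) (f0 fT : R -> R) : R :=
  2 * fT 0 - f0 T - f0 (- T).

Definition t_right (R : realType) (T : R) (f0 fT : R -> R) (k : nat) (x : R)
  : R :=
  derive1 f0 x
  + 2 * (\sum_(0 <= n < k) derive1 f0 (x + (2 * k%:R - 2 * n%:R) * T))
  - 2 * (\sum_(0 <= n < k) derive1 fT (x + (2 * k%:R - 2 * n%:R - 1) * T))
  - derive1 f0 (x + 2 * k%:R * T).

Definition t_left (R : realType) (T : R) (f0 fT : R -> R) (k : nat) (x : R)
  : R :=
  derive1 f0 x
  + 2 * (\sum_(0 <= n < k) derive1 fT (x + (2 * n%:R + 1 - 2 * k%:R) * T))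
  - 2 * (\sum_(0 <= n < k) derive1 f0 (x + 2 * (n%:R + 1 - k%:R) * T))
  - derive1 f0 (x - 2 * k%:R * T).

Definition t_fun (R : realType) (T : R) (f0 fT : R -> R) (K2 i : nat) (x : R)
  : R :=
  if (i <= 1)%N then 0
  else if (i <= K2.+1)%N then t_right T f0 fT i.-1 x
  else t_left T f0 fT (i - K2.+1) x.

(* Extended-real valued, so that a_0 = +oo and a_(K+1) = -oo have integrals
   +oo and -oo over [-T, T] without further convention. *)
Definition a_fun (R : realType) (T : R) (f0 fT : R -> R) (K1 K2 j : nat)
    (x : R) : \bar R :=
  let K := (K1 + K2 + 1)%N in
  if j == 0%N then +oo%E
  else if (j <= K)%N then
    (nth 0 (sort >=%R [seq t_fun T f0 fT K2 i x | i <- iota 1 K]) j.-1)%:E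
  else -oo%E.

Definition a_int (R : realType) (T : R) (f0 fT : R -> R) (K1 K2 j : nat)
  : \bar R :=
  (\int[@lebesgue_measure R]_(x in `[(- T)%R, T]) a_fun T f0 fT K1 K2 j x)%E.

Definition is_bracket (R : realType) (T : R) (f0 fT : R -> R) (K1 K2 j : nat)
  : Prop :=
  (j <= K1 + K2 + 1)%N /\
  (a_int T f0 fT K1 K2 j.+1 < (constA T f0 fT)%:E < a_int T f0 fT K1 K2 j)%E.

(* Main.v *)
Require Import Defs.
From HB Require Import structures.
From mathcomp Require Import all_boot all_order all_algebra.
From mathcomp Require Import all_classical all_reals all_analysis.
From mathcomp Require Import measurable_realfun.
From mathcomp Require Import ring lra zify.
Set Implicit Arguments.
Unset Strict Implicit.
Unset Printing Implicit Defensive.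
Import Order.TTheory GRing.Theory Num.Theory.
Import numFieldNormedType.Exports.
Local Open Scope classical_set_scope.
Local Open Scope ring_scope.

(** By the formula of d'Alembert an input v is continuous, has integral A over
    [-T, T] and satisfies v(x + 2T) = v(x) - t_2(x), and every C^1 function with
    these properties is an input ([input_space_elim], [input_space_of_shift]). The
    difference equation gives the values of v on the K intervals of length 2T that
    form the window as v(x) - t_i(x) with x in [-T, T], so the norm of v is the
    integral over [-T, T] of the cost, the sum of |v(x) - t_i(x)|
    ([L1norm_window]).

    For fixed x the cost is a convex piecewise affine function of v(x), with the
    slope K - 2j between a_(j+1)(x) and a_j(x). This slope does not depend on x.
    If w0 has integral A and lies between a_(j+1) and a_j, then the cost of v is
    the cost of w0, plus (K - 2j)(v - w0), plus a nonnegative excess that vanishes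
    only where v is between a_(j+1) and a_j ([cost_gap]). The linear term has
    integral 0, so the norm of every input is a constant N plus the integral of its
    excess ([input_norm]).

    A continuous w0 of this kind exists: a convex combination of a_(j+1) and a_j
    with constant weights, or a_1 or a_K translated by a constant, where j is the
    index for which A is between the two integrals ([admissible_bracket]). It is
    the L^1 limit on [-T, T] of inputs, obtained by averaging, by a cut-off near -T
    and by extension with the difference equation ([approx_inputs]). Hence the
    infimum of the norms is N, and a pre-minimum-input solution exists
    ([pms_exists]). Conversely, the inputs of any such solution have excess tending
    to 0 in L^1; the excess is Lipschitz, so the excess of their limit is 0 almost
    everywhere ([pms_limit_between]). If a_j itself has integral A, then w0 = a_j
    serves for the indices j - 1 and j at the same time, and the two conclusions
    together say that the limit is a_j. *)

(** * Derivatives and primitives on the line *)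

Lemma is_derive_addf (R : realType) (f g : R -> R) (x a b : R) :
  is_derive x (1 : R) f a -> is_derive x (1 : R) g b ->
  is_derive x (1 : R) (fun y => f y + g y) (a + b).
Proof. by move=> df dg; exact: (@is_deriveD R R R f g x 1 a b df dg). Qed.

Lemma is_derive_subf (R : realType) (f g : R -> R) (x a b : R) :
  is_derive x (1 : R) f a -> is_derive x (1 : R) g b ->
  is_derive x (1 : R) (fun y => f y - g y) (a - b).
Proof. by move=> df dg; exact: (@is_deriveB R R R f g x 1 a b df dg). Qed.

Lemma is_derive_mulf (R : realType) (f g : R -> R) (x a b : R) :
  is_derive x (1 : R) f a -> is_derive x (1 : R) g b ->
  is_derive x (1 : R) (fun y => f y * g y) (a * g x + f x * b).
Proof.
move=> df dg; have := @is_deriveM R R f g x 1 a b df dg.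
by move=> h; apply: is_derive_eq h _; rewrite addrC; congr (_ + _); exact: mulrC.
Qed.

Lemma is_derive_mulcf (R : realType) (f : R -> R) (c x a : R) :
  is_derive x (1 : R) f a -> is_derive x (1 : R) (fun y => c * f y) (c * a).
Proof. by move=> df; exact: (@is_deriveZ R R R f c x 1 a df). Qed.

Lemma is_derive_affine (R : realType) (a b x : R) :
  is_derive x (1 : R) (fun y => a + b * y) b.
Proof.
have h := @is_derive_mulcf R id b x 1 (is_derive_id _ _).
have := is_derive_addf (@is_derive_cst R R R a x 1) h.
by move=> h2; apply: is_derive_eq h2 _; rewrite add0r mulr1.
Qed.

Lemma is_derive_comp_affine (R : realType) (f : R -> R) (a b x c : R) :
  is_derive (a + b * x) (1 : R) f c ->
  is_derive x (1 : R) (fun y => f (a + b * y)) (c * b).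
Proof.
move=> df.
exact: (@is_derive1_comp R f (fun y => a + b * y) x c b df (is_derive_affine _ _ _)).
Qed.

Lemma is_derive_shift (R : realType) (f : R -> R) (a x c : R) :
  is_derive (x + a) (1 : R) f c -> is_derive x (1 : R) (fun y => f (y + a)) c.
Proof.
move=> df; have -> : (fun y => f (y + a)) = (fun y => f (a + 1 * y)).
  by apply/funext => y; rewrite mul1r addrC.
have {}df : is_derive (a + 1 * x) (1 : R) f c by rewrite mul1r addrC.
by have := is_derive_comp_affine df; rewrite mulr1.
Qed.

Lemma is_derive_continuous (R : realType) (f df : R -> R) :
  (forall x, is_derive x (1 : R) f (df x)) -> continuous f.
Proof.
move=> h x; apply: differentiable_continuous.
by apply/derivable1_diffP; apply: ex_derive.
Qed.

(** Integrals of continuous functions are handled through globally defined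
    primitives, so that linearity, translation and the splitting of intervals
    become identities between values of primitives. *)
Lemma integral_FTC2 (R : realType) (f F : R -> R) (a b : R) : a <= b ->
  continuous f -> (forall x, is_derive x (1 : R) F (f x)) ->
  (\int[@lebesgue_measure R]_(x in `[a, b]) (f x)%:E)%E = (F b - F a)%:E.
Proof.
move=> ab fc dF; have Fc : continuous F.
  by move=> x; apply: differentiable_continuous; apply/derivable1_diffP/ex_derive.
move: ab; rewrite le_eqVlt => /predU1P[<-|ab].
  by rewrite set_itv1 integral_set1 subrr.
rewrite (@continuous_FTC2 R f F)// ?EFinB//.
- exact: continuous_subspaceT.
- split.
  + by move=> x _; apply: ex_derive.
  + exact: cvg_at_right_filter (Fc a).
  + exact: cvg_at_left_filter (Fc b).
- by move=> x _; rewrite derive1E derive_val.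
Qed.

Lemma continuous_integrable_itv (R : realType) (f : R -> R) (a b : R) :
  continuous f -> (@lebesgue_measure R).-integrable `[a, b] (EFin \o f).
Proof.
move=> fc; apply: continuous_compact_integrable; first exact: segment_compact.
exact: continuous_subspaceT.
Qed.

(** A function that vanishes on the negative half-line is integrable on every
    left half-line, so its integral from minus infinity is differentiable at
    every point, without an exceptional endpoint. *)
Lemma primitive_of_left_null (R : realType) (f : R -> R) : continuous f ->
  (forall x, x <= 0 -> f x = 0) ->
  exists F : R -> R, forall x, is_derive x (1 : R) F (f x).
Proof.
move=> fc f0; exists (fun x => \int[@lebesgue_measure R]_(t in [set` Interval (BInfty _ true) (BRight x)]) f t) => x.
have xu : x < x + 1 by rewrite ltrDl.
have fi : (@lebesgue_measure R).-integrable [set` Interval (BInfty _ true) (BRight (x + 1))] (EFin \o f).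
  have -> : EFin \o f = (EFin \o f) \_ `[0, x + 1] \+ (EFin \o f) \_ `]x + 1, +oo[.
    apply/funext => y; rewrite /= !patchE.
    case: ifPn; rewrite mem_setE/= in_itv/=; last first.
      case: ifPn; rewrite mem_setE/= in_itv/= ?andbT ?add0e// => + /negP.
      case: (leP y (x+1)) => // yx _; rewrite andbT => /negP; rewrite -ltNge => y0.
      by rewrite f0// ?adde0// ltW.
    move=> /andP[_ yx]; case: ifPn => [|_]; last by rewrite adde0.
    by rewrite mem_setE/= in_itv/= andbT ltNge yx.
  apply: integrableD => //.
    apply/integrable_restrict => //.
    have := @continuous_integrable_itv R f 0 (x + 1) fc; apply: integrableS => //.
    exact: measurableI.
  apply/integrable_restrict => //.
  rewrite (_ : _ `&` _ = set0); first exact: integrable_set0.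
  by apply/seteqP; split => y //=; rewrite !in_itv/= andbT => -[y1 y2]; move: (lt_le_trans y2 y1); rewrite ltxx.
have [|d1 d2] := @continuous_FTC1 R f (BInfty _ true) x (x + 1) xu fi _ (fc x).
  by rewrite ltNyr.
apply: DeriveDef; first exact: d1.
by rewrite -derive1E; exact: d2.
Qed.

Lemma continuous_clamp (R : realType) (a b : R) :
  continuous (fun x : R => Num.min b (Num.max a x)).
Proof.
move=> x.
have cmax : {for x, continuous (fun x : R => Num.max a x)}.
  exact: (@continuous_max _ _ (cst a) id x (@cst_continuous _ _ _ _) (@cvg_id _ (nbhs x))).
exact: (@continuous_min _ _ (cst b) _ x (@cst_continuous _ _ _ _) cmax).
Qed.

(** Splitting the function with a continuous cut-off into a part that vanishes
    on the left and a part that vanishes on the right, and reflecting the second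
    part, gives a primitive on the whole line. *)
Lemma continuous_primitive (R : realType) (f : R -> R) : continuous f ->
  exists F : R -> R, forall x, is_derive x (1 : R) F (f x).
Proof.
(* The cut-off is 0 on the left of 0 and 1 on the right of 1, so that
   (1 - c (1 - x)) f(1 - x) also vanishes on the left of 0. *)
move=> fc; pose c (x : R) := Num.min 1 (Num.max 0 x).
have cc : continuous c.
  exact: continuous_clamp.
have [F1 dF1] : exists F : R -> R, forall x, is_derive x (1 : R) F (c x * f x).
  apply: primitive_of_left_null.
    by move=> x; apply: cvgM; [exact: cc|exact: fc].
  by move=> x x0; rewrite /c (max_idPl x0) (min_idPr _)// mul0r.
have [F2 dF2] : exists F : R -> R, forall x, is_derive x (1 : R) F ((1 - c (1 - x)) * f (1 - x)).
  have sc : continuous (fun x : R => 1 - x).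
    by move=> x; apply: cvgB; [exact: cvg_cst|exact: cvg_id].
  apply: primitive_of_left_null.
    move=> x; apply: cvgM.
      apply: cvgB; first exact: cvg_cst.
      exact: (continuous_comp (sc x) (cc _)).
    exact: (continuous_comp (sc x) (fc _)).
  move=> x x0; rewrite /c (max_idPr _) ?(min_idPl _) ?subrr ?mul0r//; lra.
exists (fun x => F1 x - F2 (1 - x)) => x.
have dr : is_derive x (1 : R) (fun y => F2 (1 - y)) (((1 - c (1 - (1 - x))) * f (1 - (1 - x))) * -1).
  have -> : (fun y => F2 (1 - y)) = (fun y => F2 (1 + (-1) * y)).
    by apply/funext => y; rewrite mulN1r.
  by apply: is_derive_comp_affine; rewrite mulN1r.
apply: is_derive_eq (is_derive_subf (dF1 x) dr) _.
by rewrite mulrN1 opprK subKr; ring.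
Qed.

(** * Functions on the strip and one-sided time derivatives *)

(** Composing with the clamp turns a function that is continuous on the closed
    strip into a function that is continuous on the whole plane. *)
Definition clamp (R : realType) (T t : R) : R := Num.min T (Num.max 0 t).

Lemma clamp_itv (R : realType) (T t : R) : 0 < T -> 0 <= clamp T t <= T.
Proof.
by move=> T0; rewrite /clamp le_min ge_min le_max !lexx (ltW T0).
Qed.

Lemma clampE (R : realType) (T t : R) : 0 <= t <= T -> clamp T t = t.
Proof. by move=> /andP[t0 tT]; rewrite /clamp (max_idPr t0) (min_idPr tT). Qed.

Lemma strip_continuous_clamp (R : realType) (T : R) (u : R -> R -> R) : 0 < T ->
  strip_continuous T u -> continuous (fun p : R * R => u (clamp T p.1) p.2).
Proof.
move=> T0 /subspace_continuousP h p.
have hp := h (clamp T p.1, p.2) (clamp_itv p.1 T0).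
pose g (q : R * R) := (clamp T q.1, q.2).
have gc : {for p, continuous g}.
  have c1 : (fun q : R * R => clamp T q.1) @ nbhs p --> clamp T p.1.
    apply: (@continuous_comp _ _ _ (fun q : R * R => q.1) (clamp T) p); first exact: cvg_fst.
    exact: continuous_clamp.
  have c2 : (fun q : R * R => q.2) @ nbhs p --> p.2 by exact: cvg_snd.
  exact: (cvg_pair c1 c2).
apply: (@cvg_comp _ _ _ g (fun q : R * R => u q.1 q.2) (nbhs p)
  (within [set q : R * R | 0 <= q.1 <= T] (nbhs (g p)))) => //.
move=> U /= HU.
have := gc _ HU; rewrite /nbhs/=; apply: filterS => q; apply.
exact: clamp_itv.
Qed.

Lemma mvt_between (R : realType) (f df : R -> R) (a b : R) :
  (forall x, is_derive x (1 : R) f (df x)) ->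
  exists c, `|c - a| <= `|b - a| /\ f b - f a = df c * (b - a).
Proof.
move=> h; have fc := is_derive_continuous h.
have [ab|ba|<-] := ltgtP a b.
- have [c] := @MVT R f df a b ab (fun x _ => h x) (continuous_subspaceT fc).
  rewrite in_itv/= => /andP[ac cb] e; exists c; split => //.
  rewrite !ger0_norm; lra.
- have [c] := @MVT R f df b a ba (fun x _ => h x) (continuous_subspaceT fc).
  rewrite in_itv/= => /andP[ac cb] e; exists c; split; last lra.
  rewrite !ler0_norm; lra.
- by exists a; rewrite !subrr mulr0.
Qed.

Lemma proper_within_dnbhs (R : realType) (T t : R) : 0 < T -> 0 <= t <= T ->
  ProperFilter (within `[0, T] t^').
Proof.
move=> T0 /andP[t0 tT]; apply: Build_ProperFilter.
rewrite /within/dnbhs/= => /nbhs_ballP[e /= e0 he].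
pose d := Num.min (e / 2) (T / 2).
have d0 : 0 < d by rewrite lt_min !divr_gt0.
have de : d < e by rewrite /d gt_min; apply/orP; left; lra.
have dT : d <= T / 2 by rewrite /d ge_min lexx orbT.
have [tT2|tT2] := leP t (T / 2).
- apply: (he (t + d)).
  + by rewrite /ball/= opprD addNKr normrN gtr0_norm.
  + by rewrite -subr_eq0 addrAC subrr add0r gt_eqF.
  + rewrite in_itv/=; lra.
- apply: (he (t - d)).
  + by rewrite /ball/= opprB addrC subrK gtr0_norm.
  + by rewrite -subr_eq0 addrAC subrr add0r oppr_eq0 gt_eqF.
  + rewrite in_itv/=; lra.
Qed.

(** The chain rule along a line x = x0 + sigma (s - t0), with one-sided time
    derivatives allowed: the time quotient of Phi gives alpha, and the mean value
    theorem in the space variable turns the remaining increment into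
    sigma D(s, c) with (s, c) close to (t0, x0). *)
Lemma path_derivative (R : realType) (T sigma : R) (Phi D : R -> R -> R)
    (t0 x0 alpha : R) : 0 <= t0 <= T ->
  continuous (fun p : R * R => D (clamp T p.1) p.2) ->
  (forall t x, 0 <= t <= T -> is_derive x (1 : R) (Phi t) (D t x)) ->
  time_quotient Phi t0 x0 @ within `[0, T] t0^' --> alpha ->
  (fun s => (Phi s (x0 + sigma * (s - t0)) - Phi t0 x0) / (s - t0))
    @ within `[0, T] t0^' --> alpha + sigma * D t0 x0.
Proof.
move=> t0T Dc dPhi hq.
have -> : (fun s => (Phi s (x0 + sigma * (s - t0)) - Phi t0 x0) / (s - t0)) =
    (fun s => time_quotient Phi t0 x0 s +
       (Phi s (x0 + sigma * (s - t0)) - Phi s x0) / (s - t0)).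
  by apply/funext => s; rewrite /time_quotient -mulrDl [in RHS]addrC addrA subrK.
apply: cvgD => //; apply/cvgrPdist_lt => e e0.
pose e' := e / (`|sigma| + 1).
have s1 : 0 < `|sigma| + 1 by rewrite ltr_wpDl.
have e'0 : 0 < e' by rewrite divr_gt0.
have /cvgrPdist_lt /(_ _ e'0) /nbhs_ballP[d /= d0 hd] := Dc (t0, x0).
rewrite /within/dnbhs/=; apply/nbhs_ballP; exists (d / (`|sigma| + 1)); first by rewrite /= divr_gt0.
move=> s; rewrite /ball/= => st snt; rewrite in_itv/= => sT.
have [c [cx ->]] := mvt_between x0 (x0 + sigma * (s - t0)) (fun x => dPhi s x sT).
have st0 : s - t0 != 0 by rewrite subr_eq0.
have sd : `|t0 - s| * (`|sigma| + 1) < d by rewrite -ltr_pdivlMr.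
have := hd (s, c); rewrite /ball/= /prod_ball/= /ball/= !clampE// => /(_ _).
have h1 : `|t0 - s| < d.
  by apply: le_lt_trans sd; rewrite ler_peMr// lerDr.
have h2 : `|x0 - c| < d.
  rewrite distrC; apply: le_lt_trans cx _; rewrite addrAC subrr add0r normrM.
  apply: le_lt_trans sd; rewrite mulrC (distrC s); apply: ler_wpM2l => //.
  by rewrite lerDl.
move=> /(_ (conj h1 h2)) hD.
rewrite addrAC subrr add0r mulrA mulfK// [D s c * _]mulrC -mulrBr normrM.
have : (`|sigma| + 1) * `|D t0 x0 - D s c| < e.
  by rewrite mulrC -ltr_pdivlMr.
by apply: le_lt_trans; apply: ler_wpM2r => //; rewrite lerDl.
Qed.

Lemma within_dnbhsP (R : realType) (f : R -> R) (D : set R) (t l : R) :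
  f @ within D t^' --> l <->
  forall e, 0 < e -> exists2 d, 0 < d &
    forall s, D s -> s != t -> `|s - t| < d -> `|f s - l| < e.
Proof.
split=> [/cvgrPdist_lt h e /h|h].
  rewrite /within/dnbhs/= => /nbhs_ballP[d /= d0 hd]; exists d => // s Ds st std.
  by rewrite distrC; apply: hd => //; rewrite /ball/= distrC.
apply/cvgrPdist_lt => e /h [d d0 hd].
rewrite /within/dnbhs/=; apply/nbhs_ballP; exists d => //= s; rewrite /ball/= => st snt Ds.
by rewrite distrC; apply: hd => //; rewrite distrC.
Qed.

Lemma is_derive_quotientP (R : realType) (f : R -> R) (t l : R) :
  is_derive t (1 : R) f l <->
  forall e, 0 < e -> exists2 d, 0 < d &
    forall s, s != t -> `|s - t| < d -> `|(f s - f t) / (s - t) - l| < e.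
Proof.
have -> : is_derive t (1 : R) f l <-> (fun h : R => h^-1 *: (f (h *: (1 : R) + t) - f t)) @ 0^' --> l.
  split=> [[df <-]|h]; first by exact: df.
  by apply: DeriveDef; [exact: (cvgP _ h)|exact: (cvg_lim _ h)].
split=> [/cvgrPdist_lt h e /h|h].
  rewrite /dnbhs/within/= => /nbhs_ballP[d /= d0 hd]; exists d => // s st std.
  have := hd (s - t); rewrite /ball/= sub0r normrN subr_eq0 => /(_ std st).
  by rewrite distrC [_ *: 1]mulr1 subrK [_ *: _]mulrC.
apply/cvgrPdist_lt => e /h [d d0 hd].
rewrite /dnbhs/within/=; apply/nbhs_ballP; exists d => //= s; rewrite /ball/= sub0r normrN => sd s0.
have := hd (s + t); rewrite addrK -subr_eq0 addrK => /(_ s0 sd).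
by rewrite distrC [_ *: 1]mulr1 [_ *: _]mulrC.
Qed.

Lemma is_derive_time_quotient (R : realType) (T : R) (f : R -> R -> R) (t x l : R) :
  is_derive t (1 : R) (fun s => f s x) l ->
  time_quotient f t x @ within `[0, T] t^' --> l.
Proof.
move=> /is_derive_quotientP h; apply/within_dnbhsP => e /h [d d0 hd].
by exists d => // s _; exact: hd.
Qed.

Lemma within_quotient_is_derive (R : realType) (T : R) (f : R -> R) (t l : R) :
  0 < t < T -> (fun s => (f s - f t) / (s - t)) @ within `[0, T] t^' --> l ->
  is_derive t (1 : R) f l.
Proof.
move=> /andP[t0 tT] /within_dnbhsP h; apply/is_derive_quotientP => e /h [d d0 hd].
exists (Num.min d (Num.min t (T - t))); first by rewrite !lt_min d0 t0 subr_gt0.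
move=> s st; rewrite !lt_min => /and3P[sd sb sc]; apply: hd => //; move: sb sc.
by rewrite !ltr_norml /= in_itv/= => /andP[? ?] /andP[? ?]; lra.
Qed.

Lemma within_quotient_continuous (R : realType) (T : R) (f : R -> R) (t l : R) :
  (fun s => (f s - f t) / (s - t)) @ within `[0, T] t^' --> l ->
  f @ within `[0, T] (nbhs t) --> f t.
Proof.
move=> /within_dnbhsP /(_ 1 ltr01) [d d0 hd]; apply/cvgrPdist_lt => e e0.
have l1 : 0 < `|l| + 1 by rewrite ltr_wpDl.
rewrite /within/=; apply/nbhs_ballP; exists (Num.min d (e / (`|l| + 1))).
  by rewrite /= lt_min d0 divr_gt0.
move=> s; rewrite /ball/= distrC lt_min => /andP[sd se] sT.
have [->|st] := eqVneq s t; first by rewrite subrr normr0.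
have := hd s sT st sd => hq; rewrite distrC.
have st0 : 0 < `|s - t| by rewrite normr_gt0 subr_eq0.
have : `|(f s - f t) / (s - t)| < `|l| + 1.
  by rewrite -(subrK l (_ / _)); apply: le_lt_trans (ler_normD _ _) _; rewrite addrC ltrD2l.
rewrite normrM normfV ltr_pdivrMr// => /lt_trans; apply.
by rewrite mulrC -ltr_pdivlMr.
Qed.

Lemma within_quotient0_cst (R : realType) (T : R) (f : R -> R) : 0 < T ->
  (forall t, 0 <= t <= T ->
    (fun s => (f s - f t) / (s - t)) @ within `[0, T] t^' --> (0 : R)) ->
  f T = f 0.
Proof.
move=> T0 h.
have fc : {within `[0, T], continuous f}.
  apply/subspace_continuousP => t /=; rewrite in_itv/= => tT.
  exact: within_quotient_continuous (h t tT).
have df t : t \in `]0, T[ -> is_derive t (1 : R) f (cst 0 t).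
  rewrite in_itv/= => /andP[t0 tT]; apply: (@within_quotient_is_derive R T); first by rewrite t0 tT.
  by apply: h; rewrite !ltW.
have [c _] := MVT T0 df fc.
by rewrite mul0r => /eqP; rewrite subr_eq0 => /eqP.
Qed.

Lemma continuous_fst_arg (R : realType) (f : R -> R -> R) (b : R) :
  continuous (fun p : R * R => f p.1 p.2) -> continuous (fun a => f a b).
Proof.
move=> fc a; apply: (@continuous_comp _ _ _ (fun a => (a, b)) (fun p : R * R => f p.1 p.2) a); last exact: fc.
exact: (cvg_pair (@cvg_id _ (nbhs a)) (@cvg_cst _ b _ (nbhs a) _)).
Qed.

Lemma continuous_snd_arg (R : realType) (f : R -> R -> R) (a : R) :
  continuous (fun p : R * R => f p.1 p.2) -> continuous (f a).
Proof.
move=> fc b; apply: (@continuous_comp _ _ _ (fun b => (a, b)) (fun p : R * R => f p.1 p.2) b); last exact: fc.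
exact: (cvg_pair (@cvg_cst _ a _ (nbhs b) _) (@cvg_id _ (nbhs b))).
Qed.

Lemma compact_image_bounded (R : realType) (U : topologicalType) (A : set U) (f : U -> R) :
  compact A -> {within A, continuous f} -> exists2 M, 0 <= M & forall x, A x -> `|f x| <= M.
Proof.
move=> cA fc; have /compact_bounded [M [Mr hM]] := continuous_compact fc cA.
exists (`|M| + 1); first by rewrite addr_ge0.
move=> x Ax; apply: (hM (`|M| + 1)); last by exists x.
by rewrite (le_lt_trans (ler_norm M))// ltrDl.
Qed.

Lemma continuous_bounded_itv (R : realType) (f : R -> R) (a b : R) :
  continuous f -> exists2 M, 0 <= M & forall x, a <= x <= b -> `|f x| <= M.
Proof.
move=> fc; have [M M0 hM] := compact_image_bounded (@segment_compact R a b) (continuous_subspaceT fc).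
by exists M => // x xab; apply: hM; rewrite /= in_itv.
Qed.

Lemma Rintegral_FTC2 (R : realType) (f F : R -> R) (a b : R) : a <= b ->
  continuous f -> (forall x, is_derive x (1 : R) F (f x)) ->
  \int[@lebesgue_measure R]_(x in `[a, b]) f x = F b - F a.
Proof. by move=> ab fc dF; rewrite /Rintegral (integral_FTC2 ab fc dF). Qed.

(** Dominated differentiation under the integral sign: joint continuity gives a
    constant bound for the derivative on the compact rectangle
    [0, t] * [x - 1, x + 1]. *)
Lemma is_derive_Rintegral_param (R : realType) (f fx : R -> R -> R) (t x : R) :
  continuous (fun p : R * R => fx p.1 p.2) ->
  (forall y, continuous (fun s => f s y)) ->
  (forall s y, is_derive y (1 : R) (f s) (fx s y)) ->
  is_derive x (1 : R) (fun y => \int[@lebesgue_measure R]_(s in `[0, t]) f s y)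
    (\int[@lebesgue_measure R]_(s in `[0, t]) fx s x).
Proof.
move=> fxc fc df.
have dE s y : derive (f s) y (1 : R) = fx s y by have [] := df s y.
have cK : compact (`[0, t] `*` `[x - 1, x + 1] : set (R * R)).
  by apply: compact_setX; exact: segment_compact.
have [M M0 hM] := compact_image_bounded cK (continuous_subspaceT fxc).
have Ix : `]x - 1, x + 1[%classic x.
  by rewrite /= in_itv/= ltrBlDr ltrDl ltr01.
have h1 : forall y, `]x - 1, x + 1[%classic y ->
    (@lebesgue_measure R).-integrable `[0, t] (EFin \o (fun s => f s y)).
  by move=> y _; exact: continuous_integrable_itv.
have h2 : forall y s, `]x - 1, x + 1[%classic y -> `[0, t]%classic s ->
    derivable (fun y => f s y) y (1 : R).
  by move=> y s _ _; have [] := df s y.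
have hG : (@lebesgue_measure R).-integrable `[0, t] (EFin \o cst M).
  by apply: continuous_integrable_itv => y; exact: cvg_cst.
have h3 : forall y s, `]x - 1, x + 1[%classic y -> `[0, t]%classic s ->
    `|partial1of2 (fun y s => f s y) y s| <= M.
  move=> y s; rewrite /= in_itv/= => /andP[y1 y2] st; rewrite partial1of2E.
  rewrite (dE s y).
  by apply: (hM (s, y)); split => //=; rewrite in_itv/= !ltW.
have D1 := @derivable_under_integral R _ _ (@lebesgue_measure R) (fun y s => f s y)
  `[0, t] (measurable_itv _) x (x - 1) (x + 1) Ix h1 h2 (cst M) (fun=> M0) hG h3.
have D2 := @differentiation_under_integral R _ _ (@lebesgue_measure R) (fun y s => f s y)
  `[0, t] (measurable_itv _) x (x - 1) (x + 1) Ix h1 h2 (cst M) (fun=> M0) hG h3.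
apply: DeriveDef; first exact: D1.
rewrite -derive1E D2; apply: eq_Rintegral => s _.
by rewrite partial1of2E; exact: dE.
Qed.

(** * Every solution obeys the formula of d'Alembert *)

(** Let P be the conjugate of u, P(t,x) = V(x) + (integral of q(.,x) over [0,t]).
    By construction P_t = q = u_x, and P_x = p(0,x) + (integral of q_x = p_t over
    [0,t]) = p = u_t. Hence u + P and u - P are constant along the
    characteristics x + t = cst and x - t = cst respectively. Using P instead of
    the equation for u_t + u_x and u_t - u_x avoids the symmetry of the mixed
    second derivatives. *)
Lemma wave_characteristics (R : realType) (T : R) (V : R -> R)
    (u p q pt qx : R -> R -> R) : 0 < T ->
  continuous (fun z : R * R => p (clamp T z.1) z.2) ->
  continuous (fun z : R * R => q (clamp T z.1) z.2) ->
  continuous (fun z : R * R => pt (clamp T z.1) z.2) ->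
  continuous (fun z : R * R => qx (clamp T z.1) z.2) ->
  (forall t x, 0 <= t <= T -> time_quotient u t x @ within `[0, T] t^' --> p t x) ->
  (forall t x, 0 <= t <= T -> time_quotient p t x @ within `[0, T] t^' --> pt t x) ->
  (forall t x, 0 <= t <= T -> is_derive x (1 : R) (u t) (q t x)) ->
  (forall t x, 0 <= t <= T -> is_derive x (1 : R) (q t) (qx t x)) ->
  (forall t x, 0 <= t <= T -> pt t x = qx t x) ->
  (forall x, is_derive x (1 : R) V (p 0 x)) ->
  forall c, V (c + T) - V (c - T) = 2 * u T c - u 0 (c + T) - u 0 (c - T).
Proof.
move=> T0 pc qc ptc qxc hq hqp dut dqt pde dV.
have T00 : 0 <= (0 : R) <= T by rewrite lexx ltW.
have qcs x : continuous (fun s => q (clamp T s) x) by exact: (@continuous_fst_arg R (fun s x => q (clamp T s) x) x qc).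
have [Q dQ] : {Q : R -> R -> R & forall x s, is_derive s (1 : R) (Q x) (q (clamp T s) x)}.
  apply: (@boolp.choice R (R -> R) (fun x Qx => forall s, is_derive s (1 : R) Qx (q (clamp T s) x))).
  by move=> x; exact: continuous_primitive.
pose P t x := V x + (Q x t - Q x 0).
have ptint t x : 0 <= t <= T -> \int[@lebesgue_measure R]_(s in `[0, t]) pt (clamp T s) x = p t x - p 0 x.
  move=> /andP[]; rewrite le_eqVlt => /predU1P[<- _|t0 tT].
    by rewrite set_itv1 Rintegral_set1 subrr.
  have cF : continuous (fun s => p (clamp T s) x) by exact: (@continuous_fst_arg R (fun s x => p (clamp T s) x) x pc).
  have dF s : s \in `]0, t[ -> is_derive s (1 : R) (fun s => p (clamp T s) x) (pt (clamp T s) x).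
    rewrite in_itv/= => /andP[s0 st].
    have sT : 0 <= s <= T by rewrite (ltW s0) ltW// (lt_le_trans st).
    apply: (@within_quotient_is_derive R T); first by rewrite s0 (lt_le_trans st).
    apply/within_dnbhsP => e e0; have /within_dnbhsP /(_ e e0) [d d0 hd'] := hqp s x sT.
    by exists d => // s' s'T; rewrite !clampE//; exact: hd'.
  rewrite /Rintegral (@continuous_FTC2 R _ (fun s => p (clamp T s) x))//.
  - by rewrite -EFinB /= !clampE// (ltW t0) tT.
  - by apply: continuous_subspaceT; exact: (@continuous_fst_arg R (fun s x => pt (clamp T s) x) x ptc).
  - split.
    + by move=> s st; have [] := dF s st.
    + exact: cvg_at_right_filter (cF 0).
    + exact: cvg_at_left_filter (cF t).
  - by move=> s st; rewrite derive1E; have [] := dF s st.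
have dP t x : 0 <= t <= T -> is_derive x (1 : R) (P t) (p t x).
  move=> tT; have t0 : 0 <= t by case/andP: tT.
  have -> : P t = (fun x => V x + \int[@lebesgue_measure R]_(s in `[0, t]) q (clamp T s) x).
    by apply/funext => y; rewrite /P (Rintegral_FTC2 t0 (qcs y) (dQ y)).
  have := is_derive_Rintegral_param t x qxc qcs (fun s y => dqt _ y (clamp_itv s T0)).
  move=> h; have -> : p t x = p 0 x + \int[@lebesgue_measure R]_(s in `[0, t]) qx (clamp T s) x.
    have -> : \int[@lebesgue_measure R]_(s in `[0, t]) qx (clamp T s) x = p t x - p 0 x.
      rewrite -(ptint t x tT); apply: eq_Rintegral => s _.
      by rewrite pde//; exact: clamp_itv.
    by rewrite subrKC.
  exact: is_derive_addf (dV x) h.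
have Pq t x : 0 <= t <= T -> time_quotient P t x @ within `[0, T] t^' --> q t x.
  move=> tT; apply: is_derive_time_quotient.
  have h1 : is_derive t (1 : R) (Q x) (q t x) by rewrite -{2}(clampE tT); exact: dQ.
  have h2 := is_derive_subf h1 (@is_derive_cst R R R (Q x 0) t 1).
  have h3 := is_derive_addf (@is_derive_cst R R R (V x) t 1) h2.
  by apply: is_derive_eq h3 _; rewrite add0r subr0.
(* For sigma = 1 and sigma = -1 at once: Phi = u - sigma P has time derivative
   p - sigma q and space derivative q - sigma p, so its derivative along
   x0 + sigma t is (1 - sigma^2) p = 0. *)
have charac (sigma x0 : R) : sigma * sigma = 1 ->
    u T (x0 + sigma * T) - sigma * P T (x0 + sigma * T) = u 0 x0 - sigma * P 0 x0.
  move=> sigma1; pose Phi t x := u t x - sigma * P t x.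
  pose D t x := q t x - sigma * p t x.
  have Dc : continuous (fun z : R * R => D (clamp T z.1) z.2).
    move=> z; apply: cvgB; first exact: qc.
    by apply: cvgM; [exact: cvg_cst|exact: pc].
  have dPhi t x : 0 <= t <= T -> is_derive x (1 : R) (Phi t) (D t x).
    move=> tT; apply: is_derive_subf; first exact: dut.
    by apply: is_derive_mulcf; exact: dP.
  have := @within_quotient0_cst R T (fun s => Phi s (x0 + sigma * s)) T0 _.
  rewrite mulr0 addr0; apply => t tT.
  have hPhi : time_quotient Phi t (x0 + sigma * t) @ within `[0, T] t^' -->
      p t (x0 + sigma * t) - sigma * q t (x0 + sigma * t).
    have -> : time_quotient Phi t (x0 + sigma * t) = (fun s =>
        time_quotient u t (x0 + sigma * t) s - sigma * time_quotient P t (x0 + sigma * t) s).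
      apply/funext => s; rewrite /time_quotient /Phi mulrA -mulrBl; congr (_ / _); ring.
    apply: cvgB; first exact: hq.
    by apply: cvgM; [exact: cvg_cst|exact: Pq].
  have := path_derivative (sigma := sigma) tT Dc dPhi hPhi.
  have -> : p t (x0 + sigma * t) - sigma * q t (x0 + sigma * t) +
      sigma * D t (x0 + sigma * t) = 0.
    rewrite /D mulrBr mulrA sigma1; ring.
  suff -> : (fun s => (Phi s (x0 + sigma * t + sigma * (s - t)) - Phi t (x0 + sigma * t)) / (s - t)) =
    (fun s => (Phi s (x0 + sigma * s) - Phi t (x0 + sigma * t)) / (s - t)) by [].
  by apply/funext => s; have -> : x0 + sigma * t + sigma * (s - t) = x0 + sigma * s by ring.
move=> c; have := charac 1 (c - T) (mul1r 1); have := charac (-1) (c + T) (etrans (mulrNN 1 1) (mul1r 1)).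
rewrite !mulN1r !mul1r addrK subrK /P !subrr.
lra.
Qed.

(** The formula of d'Alembert at time T, with the integral of the input over
    [c - T, c + T] expressed by a primitive. *)
Lemma solution_identity (R : realType) (T : R) (f0 fT : R -> R) (u : R -> R -> R) :
  0 < T -> is_solution T f0 fT u ->
  continuous (input T u) /\
  forall V : R -> R, (forall x, is_derive x (1 : R) V (input T u x)) ->
  forall c, V (c + T) - V (c - T) = 2 * fT c - f0 (c + T) - f0 (c - T).
Proof.
move=> T0 [[suc [hq hd [spc [hqp hdp [sptc _] _]] [sqc [_ hdq _ [sqxc _]]]]] pde i0 iT].
have pc := strip_continuous_clamp T0 spc.
have T00 : 0 <= (0 : R) <= T by rewrite lexx ltW.
split=> [|V dV c].
  have -> : input T u = (fun x => dt T u (clamp T 0) x) by rewrite clampE.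
  exact: (@continuous_snd_arg R (fun s x => dt T u (clamp T s) x) 0 pc).
have dut t x : 0 <= t <= T -> is_derive x (1 : R) (u t) (dx u t x).
  by move=> tT; apply: DeriveDef; [exact: hd|rewrite -derive1E].
have dqt t x : 0 <= t <= T -> is_derive x (1 : R) (dx u t) (dx (dx u) t x).
  by move=> tT; apply: DeriveDef; [exact: hdq|rewrite -derive1E].
have pde' t x : 0 <= t <= T -> dt T (dt T u) t x = dx (dx u) t x.
  by move=> tT; apply/eqP; rewrite -subr_eq0; apply/eqP; exact: pde.
have := wave_characteristics T0 pc (strip_continuous_clamp T0 sqc)
  (strip_continuous_clamp T0 sptc) (strip_continuous_clamp T0 sqxc) hq hqp dut dqt pde' dV c.
by rewrite (iT c) (i0 (c + T)) (i0 (c - T)).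
Qed.

(** * Solutions built from travelling waves *)

(** Regularity with witnesses for the successive derivatives, which makes the
    closure properties direct inductions. *)
Fixpoint Ck (R : realType) (k : nat) (f : R -> R) : Prop :=
  if k is k'.+1 then
    exists2 g : R -> R, (forall x, is_derive x (1 : R) f (g x)) & Ck k' g
  else continuous f.

Lemma Ck_continuous (R : realType) (k : nat) (f : R -> R) : Ck k f -> continuous f.
Proof. by case: k => [//|k] [g dg _]; exact: is_derive_continuous dg. Qed.

Lemma CkW (R : realType) (k : nat) (f : R -> R) : Ck k.+1 f -> Ck k f.
Proof.
elim: k f => [|k IH] f [g dg Cg]; first exact: is_derive_continuous dg.
by exists g => //; exact: IH.
Qed.

Lemma CkD (R : realType) (k : nat) (f g : R -> R) :
  Ck k f -> Ck k g -> Ck k (fun x => f x + g x).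
Proof.
elim: k f g => [|k IH] f g /=; first by move=> fc gc x; apply: cvgD; [exact: fc|exact: gc].
move=> [f' df Cf] [g' dg Cg]; exists (fun x => f' x + g' x); last exact: IH.
by move=> x; apply: is_derive_addf.
Qed.

Lemma CkZ (R : realType) (k : nat) (c : R) (f : R -> R) :
  Ck k f -> Ck k (fun x => c * f x).
Proof.
elim: k f => [|k IH] f /=; first by move=> fc x; apply: cvgM; [exact: cvg_cst|exact: fc].
move=> [f' df Cf]; exists (fun x => c * f' x); last exact: IH.
by move=> x; apply: is_derive_mulcf.
Qed.

Lemma CkN (R : realType) (k : nat) (f : R -> R) : Ck k f -> Ck k (fun x => - f x).
Proof.
move=> Cf; have -> : (fun x => - f x) = (fun x => -1 * f x).
  by apply/funext => x; rewrite mulN1r.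
exact: CkZ.
Qed.

Lemma smooth_Ck (R : realType) (k n : nat) (f : R -> R) :
  smooth f -> Ck k (derive1n n f).
Proof.
move=> fs; have df m x : is_derive x (1 : R) (derive1n m f) (derive1n m.+1 f x).
  by apply: DeriveDef; [exact: fs|rewrite derive1nS derive1E].
elim: k n => [|k IH] n /=; first exact: is_derive_continuous (df n).
by exists (derive1n n.+1 f).
Qed.

Lemma strip_continuous_eq (R : realType) (T : R) (u w : R -> R -> R) :
  continuous (fun p : R * R => w p.1 p.2) ->
  (forall t x, 0 <= t <= T -> u t x = w t x) -> strip_continuous T u.
Proof.
move=> wc uw; apply/subspace_continuousP => p /= pT.
apply/cvgrPdist_lt => e e0; have /cvgrPdist_lt /(_ e e0) := wc p.
rewrite /within/= => h; apply: filterS h => q hq qT.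
by move: hq; rewrite -!uw.
Qed.

Section TravellingWave.
Variables (R : realType) (T : R) (u : R -> R -> R) (F G F1 G1 : R -> R).
Hypothesis T0 : 0 < T.
Hypothesis dF : forall x, is_derive x (1 : R) F (F1 x).
Hypothesis dG : forall x, is_derive x (1 : R) G (G1 x).
Hypothesis uE : forall t x, 0 <= t <= T -> u t x = F (x + t) + G (x - t).

Lemma time_quotient_wave t x : 0 <= t <= T ->
  time_quotient u t x @ within `[0, T] t^' --> F1 (x + t) - G1 (x - t).
Proof.
move=> tT; have h : is_derive t (1 : R) (fun s => F (x + 1 * s) + G (x + -1 * s)) (F1 (x + 1 * t) * 1 + G1 (x + -1 * t) * -1).
  by apply: is_derive_addf; apply: is_derive_comp_affine.
have /within_dnbhsP h2 := @is_derive_time_quotient R T (fun s x => F (x + 1 * s) + G (x + -1 * s)) t x _ h.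
apply/within_dnbhsP => e /h2 [d d0 hd]; exists d => // s sT st std.
have := hd s sT st std; rewrite /time_quotient !uE// !mul1r !mulN1r mulr1 mulrN1.
by [].
Qed.

Lemma is_derive_wave t x : 0 <= t <= T ->
  is_derive x (1 : R) (u t) (F1 (x + t) + G1 (x - t)).
Proof.
move=> tT; have -> : u t = (fun y => F (y + t) + G (y - t)).
  by apply/funext => y; rewrite uE.
by apply: is_derive_addf; apply: is_derive_shift.
Qed.

Lemma dt_wave t x : 0 <= t <= T -> dt T u t x = F1 (x + t) - G1 (x - t).
Proof.
move=> tT; have := proper_within_dnbhs T0 tT => pf.
apply: cvg_lim => //; exact: time_quotient_wave.
Qed.

Lemma dx_wave t x : 0 <= t <= T -> dx u t x = F1 (x + t) + G1 (x - t).
Proof.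
by move=> tT; rewrite /dx derive1E; have [] := is_derive_wave x tT.
Qed.

End TravellingWave.

Lemma strip_continuous_wave (R : realType) (T : R) (u : R -> R -> R) (F G : R -> R) :
  continuous F -> continuous G ->
  (forall t x, 0 <= t <= T -> u t x = F (x + t) + G (x - t)) -> strip_continuous T u.
Proof.
move=> Fc Gc uE; apply: (strip_continuous_eq (w := fun t x => F (x + t) + G (x - t))) uE => p.
apply: cvgD.
- apply: (@continuous_comp _ _ _ (fun p : R * R => p.2 + p.1) F p); last exact: Fc.
  by apply: cvgD; [exact: cvg_snd|exact: cvg_fst].
- apply: (@continuous_comp _ _ _ (fun p : R * R => p.2 - p.1) G p); last exact: Gc.
  by apply: cvgB; [exact: cvg_snd|exact: cvg_fst].
Qed.

(** The time and space derivatives of F(x + t) + G(x - t) are again of this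
    form, with F', -G' and F', G', so the regularity on the strip follows by
    induction. Only the values at times in [0, T] are prescribed, because the
    time derivative outside this interval is arbitrary. *)
Lemma wave_strip_C (R : realType) (T : R) (k : nat) (u : R -> R -> R) (F G : R -> R) :
  0 < T -> Ck k F -> Ck k G ->
  (forall t x, 0 <= t <= T -> u t x = F (x + t) + G (x - t)) -> strip_C T k u.
Proof.
move=> T0; elim: k u F G => [|k IH] u F G CF CG uE.
  by split=> //; exact: strip_continuous_wave (Ck_continuous CF) (Ck_continuous CG) uE.
split; first exact: strip_continuous_wave (Ck_continuous CF) (Ck_continuous CG) uE.
case: CF CG => [F1 dF CF1] [G1 dG CG1]; split.
- move=> t x tT; apply/cvg_ex; exists (F1 (x + t) - G1 (x - t)).
  exact: (time_quotient_wave dF dG uE).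
- by move=> t x tT; have [] := is_derive_wave dF dG uE x tT.
- apply: (IH _ F1 (fun y => - G1 y)) => //; first exact: CkN.
  by move=> t x tT; rewrite (dt_wave T0 dF dG uE).
- apply: (IH _ F1 G1) => // t x tT; exact: (dx_wave dF dG uE).
Qed.

(** The solution is F(x + t) + G(x - t) with F = (f0 + V) / 2 and
    G = (f0 - V) / 2. *)
Lemma input_space_intro (R : realType) (T : R) (f0 fT v V : R -> R) :
  0 < T -> smooth f0 -> Ck 1 v ->
  (forall x, is_derive x (1 : R) V (v x)) ->
  (forall x, V (x + T) - V (x - T) = 2 * fT x - f0 (x + T) - f0 (x - T)) ->
  input_space T f0 fT v.
Proof.
move=> T0 f0s Cv dV VE.
have Cf : Ck 2 f0 := smooth_Ck 2 0 f0s.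
have CV : Ck 2 V by exists v.
have CF : Ck 2 (fun x => 2^-1 * (f0 x + V x)) by apply: CkZ; apply: CkD.
have CG : Ck 2 (fun x => 2^-1 * (f0 x - V x)) by apply: CkZ; apply: CkD => //; exact: CkN.
have df0 x : is_derive x (1 : R) f0 (f0^`()%classic x).
  by apply: DeriveDef; [exact: (f0s 0)|rewrite derive1E].
have dF x : is_derive x (1 : R) (fun x => 2^-1 * (f0 x + V x)) (2^-1 * (f0^`()%classic x + v x)).
  by apply: is_derive_mulcf; apply: is_derive_addf.
have dG x : is_derive x (1 : R) (fun x => 2^-1 * (f0 x - V x)) (2^-1 * (f0^`()%classic x - v x)).
  by apply: is_derive_mulcf; apply: is_derive_subf.
pose u t x := 2^-1 * (f0 (x + t) + V (x + t)) + 2^-1 * (f0 (x - t) - V (x - t)).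
have uE t x : 0 <= t <= T -> u t x = (fun x => 2^-1 * (f0 x + V x)) (x + t) + (fun x => 2^-1 * (f0 x - V x)) (x - t) by [].
have T00 : 0 <= (0 : R) <= T by rewrite lexx ltW.
exists u; last first.
  apply/funext => x; rewrite /input (dt_wave T0 dF dG uE x T00) addr0 subr0; lra.
split.
- exact: (wave_strip_C T0 CF CG uE).
- case: (CF) (CG) => [F1 dF1 [F2 dF2 _]] [G1 dG1 [G2 dG2 _]] t x tT.
  have uE1 s y : 0 <= s <= T -> dt T u s y = F1 (y + s) + (fun z => - G1 z) (y - s).
    by move=> sT; rewrite (dt_wave T0 dF1 dG1 uE y sT).
  have uE2 s y : 0 <= s <= T -> dx u s y = F1 (y + s) + G1 (y - s).
    by move=> sT; rewrite (dx_wave dF1 dG1 uE y sT).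
  have dG2N y : is_derive y (1 : R) (fun z => - G1 z) (- G2 y).
    have := is_derive_subf (@is_derive_cst R R R 0 y 1) (dG2 y).
    by rewrite sub0r; congr (is_derive _ _ _ _); apply/funext => z; rewrite /= sub0r.
  rewrite (dt_wave T0 dF2 dG2N uE1 x tT) (dx_wave dF2 dG2 uE2 x tT).
  by rewrite opprK subrr.
- move=> x; rewrite /u addr0 subr0; lra.
- move=> x; have := VE x; rewrite /u; lra.
Qed.

(** * Inputs as solutions of a difference equation *)

(** Differentiating the formula of d'Alembert at x + T gives
    v(x + 2T) = v(x) - jump(x) for every input v. It is the function t_2. *)
Definition jump (R : realType) (T : R) (f0 fT : R -> R) (x : R) : R :=
  derive1 f0 x + derive1 f0 (x + 2 * T) - 2 * derive1 fT (x + T).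

Lemma smooth_is_derive (R : realType) (f : R -> R) (x : R) :
  smooth f -> is_derive x (1 : R) f (derive1 f x).
Proof. by move=> fs; apply: DeriveDef; [exact: (fs 0)|rewrite derive1E]. Qed.

Lemma is_derive_uniq (R : realType) (f : R -> R) (x a b : R) :
  is_derive x (1 : R) f a -> is_derive x (1 : R) f b -> a = b.
Proof. by move=> [_ <-] [_ <-]. Qed.

(** The difference equation is the derivative of the formula of d'Alembert, and
    the value of the integral over [-T, T] is that formula at 0. *)
Lemma input_space_elim (R : realType) (T : R) (f0 fT v : R -> R) :
  0 < T -> smooth f0 -> smooth fT -> input_space T f0 fT v ->
  [/\ continuous v, forall x, v (x + 2 * T) = v x - jump T f0 fT x &
    forall V : R -> R, (forall x, is_derive x (1 : R) V (v x)) ->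
      V T - V (- T) = constA T f0 fT].
Proof.
move=> T0 f0s fTs [u su ->]; have [vc hV] := solution_identity T0 su.
set v' := input T u in vc hV *; split => // [x|V dV]; last first.
  by have := hV V dV 0; rewrite !add0r /constA.
have [V dV] := continuous_primitive vc.
have h1 : is_derive (x + T) (1 : R) (fun y => V (y + T) - V (y + - T))
    (v' (x + T + T) - v' (x + T + - T)).
  by apply: is_derive_subf; apply: is_derive_shift.
have h2 : is_derive (x + T) (1 : R) (fun y => 2 * fT y - f0 (y + T) - f0 (y + - T))
    (2 * derive1 fT (x + T) - derive1 f0 (x + T + T) - derive1 f0 (x + T + - T)).
  apply: is_derive_subf; last by apply: is_derive_shift; exact: smooth_is_derive.
  apply: is_derive_subf; last by apply: is_derive_shift; exact: smooth_is_derive.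
  by apply: is_derive_mulcf; exact: smooth_is_derive.
have E : (fun y => V (y + T) - V (y + - T)) = (fun y => 2 * fT y - f0 (y + T) - f0 (y + - T)).
  by apply/funext => y; rewrite (hV V dV).
rewrite E in h1; have := is_derive_uniq h1 h2.
rewrite addrK -addrA (_ : T + T = 2 * T); last by rewrite mulr2n mulrDl mul1r.
by rewrite /jump; lra.
Qed.

(** By the difference equation the two sides of the formula of d'Alembert have
    the same derivative, and the integral condition makes them agree at 0. *)
Lemma input_space_of_shift (R : realType) (T : R) (f0 fT v V : R -> R) :
  0 < T -> smooth f0 -> smooth fT -> Ck 1 v ->
  (forall x, is_derive x (1 : R) V (v x)) ->
  (forall x, v (x + 2 * T) = v x - jump T f0 fT x) ->
  V T - V (- T) = constA T f0 fT -> input_space T f0 fT v.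
Proof.
move=> T0 f0s fTs Cv dV vs VA; apply: (input_space_intro T0 f0s Cv dV) => x.
pose g y := V (y + T) - V (y + - T) - (2 * fT y - f0 (y + T) - f0 (y + - T)).
have dg y : is_derive y (1 : R) g 0.
  have h : is_derive y (1 : R) g (v (y + T) - v (y + - T) -
     (2 * derive1 fT y - derive1 f0 (y + T) - derive1 f0 (y + - T))).
    apply: is_derive_subf; first by apply: is_derive_subf; apply: is_derive_shift.
    apply: is_derive_subf; last by apply: is_derive_shift; exact: smooth_is_derive.
    apply: is_derive_subf; last by apply: is_derive_shift; exact: smooth_is_derive.
    by apply: is_derive_mulcf; exact: smooth_is_derive.
  apply: is_derive_eq h _.
  have := vs (y + - T); rewrite /jump.
  have -> : y + - T + 2 * T = y + T by ring.
  have -> : y + - T + T = y by ring.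
  lra.
have := is_derive_0_is_cst x 0 dg; rewrite /g !add0r.
move: VA; rewrite /constA; lra.
Qed.

Lemma t_right0 (R : realType) (T : R) (f0 fT : R -> R) (x : R) : t_right T f0 fT 0 x = 0.
Proof. by rewrite /t_right !big_geq// !(mulr0, mul0r, addr0) subr0 subrr. Qed.

(** Going from k to k + 1 adds one term in front of each sum and reindexes the
    others, so the increment is the jump at x + 2kT. *)
Lemma t_rightS (R : realType) (T : R) (f0 fT : R -> R) (k : nat) (x : R) :
  t_right T f0 fT k.+1 x = t_right T f0 fT k x + jump T f0 fT (x + 2 * k%:R * T).
Proof.
rewrite /t_right /jump !big_nat_recl//.
rewrite (eq_big_nat _ _ (F2 := fun n => derive1 f0 (x + (2 * k%:R - 2 * n%:R) * T))); last first.
  by move=> n _; congr (derive1 _ _); rewrite !(natr1, mulrS) -?natr1; ring.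
rewrite [X in _ - 2 * (_ + X)](eq_big_nat _ _ (F2 := fun n => derive1 fT (x + (2 * k%:R - 2 * n%:R - 1) * T))); last first.
  by move=> n _; congr (derive1 _ _); rewrite -!natr1; ring.
have -> : x + (2 * k.+1%:R - 2 * 0%:R) * T = x + 2 * k%:R * T + 2 * T by rewrite -natr1; ring.
have -> : x + (2 * k.+1%:R - 2 * 0%:R - 1) * T = x + 2 * k%:R * T + T by rewrite -natr1; ring.
have -> : x + 2 * k.+1%:R * T = x + 2 * k%:R * T + 2 * T by rewrite -natr1; ring.
ring.
Qed.

Lemma t_left0 (R : realType) (T : R) (f0 fT : R -> R) (x : R) : t_left T f0 fT 0 x = 0.
Proof. by rewrite /t_left !big_geq// !(mulr0, mul0r, addr0) !subr0 subrr. Qed.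

Lemma t_leftS (R : realType) (T : R) (f0 fT : R -> R) (k : nat) (x : R) :
  t_left T f0 fT k.+1 x = t_left T f0 fT k x - jump T f0 fT (x - 2 * k.+1%:R * T).
Proof.
rewrite /t_left /jump !big_nat_recl//.
rewrite (eq_big_nat _ _ (F2 := fun n => derive1 fT (x + (2 * n%:R + 1 - 2 * k%:R) * T))); last first.
  by move=> n _; congr (derive1 _ _); rewrite -!natr1; ring.
rewrite [X in _ - 2 * (_ + X)](eq_big_nat _ _ (F2 := fun n => derive1 f0 (x + 2 * (n%:R + 1 - k%:R) * T))); last first.
  by move=> n _; congr (derive1 _ _); rewrite -!natr1; ring.
have -> : x + (2 * 0%:R + 1 - 2 * k.+1%:R) * T = x - 2 * k.+1%:R * T + T by rewrite -natr1; ring.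
have -> : x + 2 * (0%:R + 1 - k.+1%:R) * T = x - 2 * k.+1%:R * T + 2 * T by rewrite -natr1; ring.
have -> : x - 2 * k%:R * T = x - 2 * k.+1%:R * T + 2 * T by rewrite -natr1; ring.
ring.
Qed.

Lemma shift_right (R : realType) (T : R) (f0 fT v : R -> R) (k : nat) (x : R) :
  (forall x, v (x + 2 * T) = v x - jump T f0 fT x) ->
  v (x + 2 * k%:R * T) = v x - t_right T f0 fT k x.
Proof.
move=> vs; elim: k => [|k IH]; first by rewrite t_right0 mulr0 mul0r addr0 subr0.
have -> : x + 2 * k.+1%:R * T = x + 2 * k%:R * T + 2 * T by rewrite -natr1; ring.
rewrite vs IH t_rightS; lra.
Qed.

Lemma shift_left (R : realType) (T : R) (f0 fT v : R -> R) (k : nat) (x : R) :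
  (forall x, v (x + 2 * T) = v x - jump T f0 fT x) ->
  v (x - 2 * k%:R * T) = v x - t_left T f0 fT k x.
Proof.
move=> vs; elim: k => [|k IH]; first by rewrite t_left0 mulr0 mul0r !subr0.
have := vs (x - 2 * k.+1%:R * T).
have -> : x - 2 * k.+1%:R * T + 2 * T = x - 2 * k%:R * T by rewrite -natr1; ring.
rewrite t_leftS IH; lra.
Qed.

(** * The norm of an input as an integral over one period *)

Lemma is_derive_sum_seq (R : realType) (I : Type) (r : seq I) (F f : I -> R -> R) (x : R) :
  (forall i, is_derive x (1 : R) (F i) (f i x)) ->
  is_derive x (1 : R) (fun y => \sum_(i <- r) F i y) (\sum_(i <- r) f i x).
Proof.
move=> dF; elim: r => [|i r IH].
  have -> : (fun y => \sum_(i <- [::]) F i y) = cst (0 : R).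
    by apply/funext => y; rewrite big_nil.
  by rewrite big_nil; exact: is_derive_cst.
have -> : (fun y => \sum_(i <- i :: r) F i y) = (fun y => F i y + \sum_(i <- r) F i y).
  by apply/funext => y; rewrite big_cons.
by rewrite big_cons; apply: is_derive_addf.
Qed.

Lemma continuous_sum_seq (R : realType) (I : Type) (r : seq I) (f : I -> R -> R) :
  (forall i, continuous (f i)) -> continuous (fun y => \sum_(i <- r) f i y).
Proof.
move=> fc; elim: r => [|i r IH].
  have -> : (fun y => \sum_(i <- [::]) f i y) = cst (0 : R).
    by apply/funext => y; rewrite big_nil.
  by move=> x; exact: cvg_cst.
have -> : (fun y => \sum_(i <- i :: r) f i y) = (fun y => f i y + \sum_(i <- r) f i y).
  by apply/funext => y; rewrite big_cons.
by move=> x; apply: cvgD; [exact: fc|exact: IH].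
Qed.

Lemma continuous_shift (R : realType) (f : R -> R) (a : R) :
  continuous f -> continuous (fun x => f (x + a)).
Proof.
move=> fc x; apply: (@continuous_comp _ _ _ (fun x => x + a) f x); last exact: fc.
by apply: cvgD; [exact: cvg_id|exact: cvg_cst].
Qed.

Lemma continuous_abs (R : realType) (f : R -> R) :
  continuous f -> continuous (fun x => `|f x|).
Proof. by move=> fc x; apply: cvg_norm; exact: fc. Qed.

(** The i-th of the K intervals of length 2T that form the window is
    [-T, T] + block i * T: for i = 1, ..., K2 + 1 the blocks go to the right
    starting from [-T, T] itself, and the others go to the left. *)
Definition block (R : realType) (K2 i : nat) : R :=
  if (i <= K2.+1)%N then 2 * i.-1%:R else - (2 * (i - K2.+1)%:R).

(** Integrand of the norm: the sum of the absolute values that an input takes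
    at the translates of x, when its value at x is s. *)
Definition cost (R : realType) (T : R) (f0 fT : R -> R) (K1 K2 : nat) (x s : R) : R :=
  \sum_(i <- iota 1 (K1 + K2 + 1)) `|s - t_fun T f0 fT K2 i x|.

Lemma block_shift (R : realType) (T : R) (f0 fT v : R -> R) (K2 i : nat) (x : R) :
  (forall x, v (x + 2 * T) = v x - jump T f0 fT x) ->
  v (x + block R K2 i * T) = v x - t_fun T f0 fT K2 i x.
Proof.
move=> vs; rewrite /block /t_fun; case: (leqP i 1) => [i1|i1].
  rewrite (leq_trans i1)//; have -> : i.-1 = 0%N by lia.
  by rewrite mulr0 mul0r addr0 subr0.
case: ifP => _; first exact: shift_right.
by rewrite mulNr; exact: shift_left.
Qed.

Lemma telescope_blocks (R : realType) (T : R) (N : R -> R) (K1 K2 : nat) :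
  \sum_(i <- iota 1 (K1 + K2 + 1)) (N (T + block R K2 i * T) - N (- T + block R K2 i * T)) =
  N ((2 * K2%:R + 1) * T) - N (- ((2 * K1%:R + 1) * T)).
Proof.
have -> : (K1 + K2 + 1 = K2.+1 + K1)%N by lia.
rewrite iotaD big_cat/=.
have -> : \sum_(i <- iota 1 K2.+1) (N (T + block R K2 i * T) - N (- T + block R K2 i * T)) =
    N ((2 * K2%:R + 1) * T) - N (- T).
  transitivity (\sum_(0 <= k < K2.+1) (N ((2 * k.+1%:R - 1) * T) - N ((2 * k%:R - 1) * T))).
    have -> : iota 1 K2.+1 = [seq (1 + k)%N | k <- iota 0 K2.+1] by exact: (iotaDl 1 0).
    rewrite big_map /index_iota subn0.
    apply: eq_big_seq => k; rewrite mem_iota add0n => /andP[_ kK].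
    rewrite /block add1n kK/= -natr1.
    by congr (N _ - N _); ring.
  rewrite (telescope_sumr (fun k => N ((2 * k%:R - 1) * T)))// -natr1.
  by congr (N _ - N _); ring.
have -> : \sum_(i <- iota (1 + K2.+1)%N K1) (N (T + block R K2 i * T) - N (- T + block R K2 i * T)) =
    N (- T) - N (- ((2 * K1%:R + 1) * T)).
  rewrite -opprB; apply/eqP; rewrite -subr_eq0 opprK; apply/eqP.
  transitivity (\sum_(i <- iota (1 + K2.+1)%N K1) (N (T + block R K2 i * T) - N (- T + block R K2 i * T)) +
     \sum_(0 <= k < K1) (N (- ((2 * k.+1%:R + 1) * T)) - N (- ((2 * k%:R + 1) * T)))).
    rewrite (telescope_sumr (fun k => N (- ((2 * k%:R + 1) * T))))//.
    by rewrite mulr0 add0r mul1r.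
  have -> : iota (1 + K2.+1)%N K1 = [seq (1 + K2.+1 + k)%N | k <- iota 0 K1].
    by rewrite -[in LHS](addn0 (1 + K2.+1)%N); exact: iotaDl.
  rewrite big_map /index_iota subn0 -big_split/=.
  apply: big1_seq => k /= _; rewrite /block.
  have -> : (1 + K2.+1 + k <= K2.+1)%N = false by lia.
  have -> : (1 + K2.+1 + k - K2.+1 = k.+1)%N by lia.
  have -> : T + - (2 * k.+1%:R) * T = - ((2 * k%:R + 1) * T) by rewrite -natr1; ring.
  have -> : - T + - (2 * k.+1%:R) * T = - ((2 * k.+1%:R + 1) * T) by ring.
  by rewrite addrA subrK subrr.
lra.
Qed.

(** With N a primitive of |v|, the sum of N(x + block i * T) is a primitive of
    the cost, and its increment over [-T, T] telescopes to the increment of N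
    over the window. *)
Lemma L1norm_window (R : realType) (T : R) (f0 fT v : R -> R) (K1 K2 : nat) :
  0 < T -> continuous v -> (forall x, v (x + 2 * T) = v x - jump T f0 fT x) ->
  L1norm (window T K1 K2) v =
  (\int[@lebesgue_measure R]_(x in `[(- T)%R, T]) (cost T f0 fT K1 K2 x (v x))%:E)%E.
Proof.
move=> T0 vc vs; have avc := continuous_abs vc.
have [N dN] := continuous_primitive avc.
rewrite /L1norm /window (integral_FTC2 (F := N))//; last first.
  have := ler0n R K1; have := ler0n R K2; nra.
have E : (fun x => cost T f0 fT K1 K2 x (v x)) =
    (fun x => \sum_(i <- iota 1 (K1 + K2 + 1)) `|v (x + block R K2 i * T)|).
  by apply/funext => x; apply: eq_bigr => i _; rewrite (block_shift _ _ _ vs).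
under eq_integral do rewrite (congr1 (fun f => f _) E).
have TT : - T <= T by lra.
have gc : continuous (fun x => \sum_(i <- iota 1 (K1 + K2 + 1)) `|v (x + block R K2 i * T)|).
  by apply: continuous_sum_seq => i; exact: (@continuous_shift R (fun x => `|v x|)).
have dG x : is_derive x (1 : R) (fun x => \sum_(i <- iota 1 (K1 + K2 + 1)) N (x + block R K2 i * T))
    (\sum_(i <- iota 1 (K1 + K2 + 1)) `|v (x + block R K2 i * T)|).
  apply: (@is_derive_sum_seq R nat _ (fun i x => N (x + block R K2 i * T))
    (fun i x => `|v (x + block R K2 i * T)|)) => i.
  by apply: is_derive_shift; exact: dN.
by rewrite (integral_FTC2 TT gc dG) -sumrB telescope_blocks.
Qed.

(** * Order statistics and sums of distances *)

Definition dsort (R : realType) (s : seq R) : seq R := sort >=%R s.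

Lemma dsort_anti (R : realType) (s : seq R) (i j : nat) :
  (i <= j < size s)%N -> nth 0 (dsort s) j <= nth 0 (dsort s) i.
Proof.
move=> /andP[ij js]; have ss : sorted >=%R (dsort s) by apply: sort_sorted => x y; exact: le_total.
have tr : transitive (>=%R : rel R) by move=> x y z /[swap]; exact: le_trans.
have rf : reflexive (>=%R : rel R) by move=> x; exact: lexx.
apply: (sorted_leq_nth tr rf 0 ss); rewrite ?inE ?size_sort//.
exact: leq_ltn_trans js.
Qed.

(** In a decreasing sequence the terms that are at least c form an initial
    segment, so comparisons with order statistics reduce to counting. *)
Lemma dsort_rank (R : realType) (s : seq R) (i : nat) (c : R) : (i < size s)%N ->
  (c <= nth 0 (dsort s) i) = (i < count (fun y => (c <= y)%R) s)%N.
Proof.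
move=> is_; set p := fun y => (c <= y)%R.
have -> : count p s = count p (dsort s) by apply/permP; rewrite perm_sym; apply/permPl; exact: perm_sort.
have szd : size (dsort s) = size s by rewrite size_sort.
rewrite -[in RHS](cat_take_drop i (dsort s)) count_cat.
have [ci|ci] := leP c (nth 0 (dsort s) i).
  have szt : size (take i (dsort s)) = i by rewrite size_takel// szd ltnW.
  have : all p (take i (dsort s)).
    apply/(all_nthP 0) => k; rewrite szt => ki; rewrite nth_take// /p.
    by apply: le_trans ci _; apply: dsort_anti; rewrite (ltnW ki).
  rewrite all_count szt => /eqP ->.
  have pi : p (nth 0 (dsort s) i) by exact: ci.
  by rewrite (drop_nth 0) ?szd//= pi add1n addnS ltnS leq_addr.
have -> : count p (drop i (dsort s)) = 0%N.
  apply/eqP; rewrite -leqn0 leqNgt -has_count; apply/negP => /(has_nthP 0)[k].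
  rewrite size_drop szd nth_drop /p => ks; apply/negP; rewrite -ltNge.
  by apply: le_lt_trans ci; apply: dsort_anti; lia.
rewrite addn0; apply/esym/negbTE; rewrite -leqNgt.
by apply: leq_trans (count_size _ _) _; rewrite size_take szd is_.
Qed.

(** By the rank criterion: if the i-th largest value of g is a and each f is
    within e of g, then as many values of f are at least a - e. *)
Lemma dsort_lipschitz (R : realType) (I : eqType) (r : seq I) (f g : I -> R) (e : R) (k : nat) :
  (k < size r)%N ->
  (forall i, i \in r -> `|f i - g i| <= e) ->
  `|nth 0 (dsort (map f r)) k - nth 0 (dsort (map g r)) k| <= e.
Proof.
move=> kr fg.
have H (f1 g1 : I -> R) : (forall i, i \in r -> `|f1 i - g1 i| <= e) ->
    nth 0 (dsort (map g1 r)) k - e <= nth 0 (dsort (map f1 r)) k.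
  move=> h; rewrite dsort_rank ?size_map//.
  have : (k < count (fun y => (nth 0 (dsort (map g1 r)) k <= y)%R) (map g1 r))%N.
    by rewrite -dsort_rank ?size_map.
  move=> /leq_trans; apply; rewrite !count_map.
  set p := preim g1 _; rewrite (@eq_in_count _ _ (fun i => (i \in r) && p i)) => [|i /= ->//].
  apply: sub_count => i /= /andP[ir]; rewrite /p /= => hi; have := h i ir.
  by rewrite ler_norml => /andP[]; lra.
have h1 := H f g fg.
have h2 : nth 0 (dsort (map f r)) k - e <= nth 0 (dsort (map g r)) k.
  by apply: H => // i ir; rewrite distrC; exact: fg.
rewrite ler_norml; lra.
Qed.

Lemma continuous_dsort (R : realType) (I : eqType) (r : seq I) (f : I -> R -> R) (k : nat) :
  (k < size r)%N -> (forall i, continuous (f i)) ->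
  continuous (fun x => nth 0 (dsort (map (f^~ x) r)) k).
Proof.
move=> kr fc x; apply/cvgrPdist_le => e e0.
have h : nbhs x (fun y => forall i, i \in r -> `|f i x - f i y| <= e).
  elim: r {kr} => [|i r IH]; first exact: filterE.
  have /cvgrPdist_le /(_ e e0) h := fc i x.
  move: h IH; apply: filterS2 => y h1 h2 k'.
  by rewrite inE => /predU1P[->|k'r]; [exact: h1|exact: h2].
by move: h; apply: filterS => y h; apply: dsort_lipschitz.
Qed.

Lemma sum_signs (R : realType) (K j : nat) : (j <= K)%N ->
  \sum_(0 <= i < K) (if (i < j)%N then - 1 else 1 : R) = K%:R - 2 * j%:R.
Proof.
move=> jK; rewrite (big_cat_nat (n := j))//=.
rewrite (eq_big_nat _ _ (F2 := fun=> - 1 : R)); last by move=> i /andP[_ ->].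
rewrite [X in _ + X](eq_big_nat _ _ (F2 := fun=> 1 : R)); last first.
  by move=> i /andP[ji _]; rewrite ltnNge ji.
rewrite !sumr_const_nat subn0 mulNrn natrB//; lra.
Qed.

(** Exact expansion of c |-> (sum of |c - y|) at w, when w lies
    below the j largest terms and above the others. Termwise,
    |c - b| - |w - b| is -(c - w) + 2 max(0, c - b) if w <= b and
    (c - w) + 2 max(0, b - c) if b <= w. The slope size - 2j depends only on j,
    so the linear term will integrate to zero against a fixed mean. *)
Lemma cost_gap (R : realType) (s : seq R) (j : nat) (w c : R) : (j <= size s)%N ->
  (forall i, (i < j)%N -> w <= nth 0 (dsort s) i) ->
  (forall i, (j <= i < size s)%N -> nth 0 (dsort s) i <= w) ->
  \sum_(y <- s) `|c - y| = \sum_(y <- s) `|w - y| +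
    ((size s)%:R - 2 * j%:R) * (c - w) +
    2 * \sum_(0 <= i < size s) (if (i < j)%N then Num.max 0 (c - nth 0 (dsort s) i)
       else Num.max 0 (nth 0 (dsort s) i - c)).
Proof.
move=> js h1 h2.
have E (z : R) : \sum_(y <- s) `|z - y| = \sum_(0 <= i < size s) `|z - nth 0 (dsort s) i|.
  rewrite -(perm_big _ (permEl (perm_sort >=%R s))) /= (big_nth 0) size_sort.
  by [].
rewrite !E -sum_signs// big_distrl big_distrr/= -!big_split/=.
apply: eq_big_nat => i /andP[_ iK]; case: ifPn => [ij|]; last rewrite -leqNgt => ij.
- have := h1 i ij; set b := nth _ _ _ => wb; rewrite (ler0_norm (x := w - b)) ?subr_le0//.
  by case: (leP 0 (c - b)) => cb; [rewrite ger0_norm//|rewrite ltr0_norm//]; lra.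
- have := h2 i; rewrite ij iK => /(_ isT); set b := nth _ _ _ => wb; rewrite (ger0_norm (x := w - b)) ?subr_ge0//.
  by case: (leP 0 (b - c)) => cb; [rewrite ler0_norm|rewrite gtr0_norm]; lra.
Qed.

(** * Extending a function by the difference equation *)

Lemma CkM (R : realType) (k : nat) (f g : R -> R) :
  Ck k f -> Ck k g -> Ck k (fun x => f x * g x).
Proof.
elim: k f g => [|k IH] f g; first by move=> fc gc x; apply: cvgM; [exact: fc|exact: gc].
move=> Cf Cg; have := CkW Cf; have := CkW Cg.
case: Cf Cg => [f' df Cf'] [g' dg Cg'] Cg Cf.
exists (fun x => f' x * g x + f x * g' x); last by apply: CkD; exact: IH.
by move=> x; apply: is_derive_mulf.
Qed.

Lemma Ck_cst (R : realType) (k : nat) (c : R) : Ck k (fun=> c).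
Proof.
elim: k c => [|k IH] c /=; first by move=> x; exact: cvg_cst.
by exists (fun=> 0) => // x; exact: is_derive_cst.
Qed.

Lemma Ck_comp_affine (R : realType) (k : nat) (f : R -> R) (a b : R) :
  Ck k f -> Ck k (fun x => f (a + b * x)).
Proof.
elim: k f => [|k IH] f.
  move=> fc x; apply: (@continuous_comp _ _ _ (fun x => a + b * x) f x); last exact: fc.
  by apply: cvgD; [exact: cvg_cst|apply: cvgM; [exact: cvg_cst|exact: cvg_id]].
move=> [f' df Cf']; exists (fun x => f' (a + b * x) * b).
  by move=> x; apply: is_derive_comp_affine.
by apply: CkM; [exact: IH|exact: Ck_cst].
Qed.

Lemma Ck_shift (R : realType) (k : nat) (f : R -> R) (a : R) :
  Ck k f -> Ck k (fun x => f (x + a)).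
Proof.
move=> Cf; have -> : (fun x => f (x + a)) = (fun x => f (a + 1 * x)).
  by apply/funext => x; rewrite mul1r addrC.
exact: Ck_comp_affine.
Qed.

Lemma Ck_opp (R : realType) (k : nat) (f : R -> R) :
  Ck k f -> Ck k (fun x => f (- x)).
Proof.
move=> Cf; have -> : (fun x => f (- x)) = (fun x => f (0 + -1 * x)).
  by apply/funext => x; rewrite add0r mulN1r.
exact: Ck_comp_affine.
Qed.

Lemma is_derive_local (R : realType) (f g : R -> R) (x l r : R) : 0 < r ->
  (forall y, `|y - x| < r -> f y = g y) ->
  is_derive x (1 : R) g l -> is_derive x (1 : R) f l.
Proof.
move=> r0 fg /is_derive_quotientP h; apply/is_derive_quotientP => e /h [d d0 hd].
exists (Num.min d r); first by rewrite lt_min d0.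
move=> s sx; rewrite lt_min => /andP[sd sr]; rewrite !fg ?subrr ?normr0//.
exact: hd.
Qed.

Lemma continuous_local (R : realType) (f g : R -> R) (x r : R) : 0 < r ->
  (forall y, `|y - x| < r -> f y = g y) ->
  {for x, continuous g} -> {for x, continuous f}.
Proof.
move=> r0 fg gx; apply/cvgrPdist_lt => e e0.
have /cvgrPdist_lt /(_ e e0) /nbhs_ballP[d /= d0 hd] := gx.
apply/nbhs_ballP; exists (Num.min d r); first by rewrite /= lt_min d0.
move=> y; rewrite /ball/= lt_min => /andP[yd yr].
rewrite !fg ?subrr ?normr0//; last by rewrite distrC.
exact: hd.
Qed.

(** At x = a only the values on the left of a are known, and they suffice since
    the derivative is assumed to exist. *)
Lemma is_derive_left_null (R : realType) (g : R -> R) (a x l : R) :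
  (forall y, y <= a -> g y = 0) -> x <= a -> is_derive x (1 : R) g l -> l = 0.
Proof.
move=> g0 xa /is_derive_quotientP h; apply/eqP/negPn/negP => l0.
have [|d d0 hd] := h `|l|; first by rewrite normr_gt0.
have h1 : x - d / 2 != x.
  by rewrite -subr_eq0 addrAC subrr add0r oppr_eq0 gt_eqF// divr_gt0.
have h2 : `|x - d / 2 - x| < d.
  by rewrite addrAC subrr add0r normrN gtr0_norm ?divr_gt0//; lra.
have := hd _ h1 h2; rewrite !g0//; last lra.
by rewrite subrr mul0r sub0r normrN ltxx.
Qed.

(** The locally finite sum of g(x), g(x - 2T), g(x - 4T), ... for a function g
    that vanishes on the left of -T: the upper index is large enough to reach
    that half-line. *)
Definition right_sum (R : realType) (T : R) (g : R -> R) (x : R) : R :=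
  \sum_(0 <= k < (Num.truncn ((`|x| + T) / T)).+1) g (x - 2 * k%:R * T).

(** Any large enough number of terms may be used. Hence near each point the sum
    has a fixed number of terms, which gives its regularity. *)
Lemma right_sumE (R : realType) (T : R) (g : R -> R) (n : nat) (x : R) : 0 < T ->
  (forall y, y <= - T -> g y = 0) -> x + T <= 2 * n%:R * T ->
  right_sum T g x = \sum_(0 <= k < n) g (x - 2 * k%:R * T).
Proof.
move=> T0 g0 xn; have H m p : (m <= p)%N -> x + T <= 2 * m%:R * T ->
    \sum_(0 <= k < p) g (x - 2 * k%:R * T) = \sum_(0 <= k < m) g (x - 2 * k%:R * T).
  move=> mp xm; rewrite (big_cat_nat (n := m))//= [X in _ + X]big_nat_cond [X in _ + X]big1 ?addr0//.
  move=> k; rewrite andbT => /andP[mk _]; apply: g0.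
  have : m%:R * T <= k%:R * T by rewrite ler_wpM2r ?(ltW T0)// ler_nat.
  lra.
rewrite /right_sum; set N := (_.+1).
have xN : x + T <= 2 * N%:R * T.
  have : (`|x| + T) / T < N%:R by exact: truncnS_gt.
  move: N => N.
  rewrite ltr_pdivrMr// => h.
  have := ler_norm x; have := normr_ge0 x; lra.
by have [nN|/ltnW Nn] := leqP n N; [exact: H|apply/esym; exact: H].
Qed.

Lemma large_nat (R : realType) (T x : R) : 0 < T ->
  exists n : nat, x + T <= 2 * n%:R * T.
Proof.
move=> T0; exists (Num.truncn ((`|x| + T) / T)).+1.
have := truncnS_gt ((`|x| + T) / T); set n := (_.+1); move: n => n.
rewrite ltr_pdivrMr// => h; have := ler_norm x; have := normr_ge0 x; lra.
Qed.

Lemma right_sum_rec (R : realType) (T : R) (g : R -> R) (x : R) : 0 < T -> (forall y, y <= - T -> g y = 0) ->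
  right_sum T g x = g x + right_sum T g (x - 2 * T).
Proof.
move=> T0 g0; have [n xn] := large_nat x T0.
rewrite (right_sumE (n := n.+1) T0 g0); last by rewrite -natr1; lra.
rewrite (right_sumE (n := n) T0 g0); last lra.
rewrite big_nat_recl//= mulr0 mul0r subr0; congr (_ + _).
by apply: eq_big_nat => k _; congr g; rewrite -natr1; ring.
Qed.

Lemma right_sum_id (R : realType) (T : R) (g : R -> R) (x : R) : 0 < T -> (forall y, y <= - T -> g y = 0) ->
  x <= T -> right_sum T g x = g x.
Proof.
move=> T0 g0 xT; rewrite (right_sumE (n := 1) T0 g0); last lra.
by rewrite big_nat1 mulr0 mul0r subr0.
Qed.

Lemma Ck_right_sum (R : realType) (T : R) (g : R -> R) : 0 < T -> (forall y, y <= - T -> g y = 0) ->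
  Ck 1 g -> Ck 1 (right_sum T g).
Proof.
move=> T0 g0 [g' dg /= g'c].
have g'0 y : y <= - T -> g' y = 0.
  by move=> yT; exact: is_derive_left_null g0 yT (dg y).
exists (right_sum T g') => [x|x /=].
  have [n xn] := large_nat (x + 1) T0.
  rewrite (right_sumE (n := n) T0 g'0); last lra.
  apply: (@is_derive_local _ _ (fun y => \sum_(0 <= k < n) g (y - 2 * k%:R * T)) x _ 1 ltr01).
    by move=> y; rewrite ltr_norml => /andP[y1 y2]; apply: right_sumE => //; lra.
  apply: (@is_derive_sum_seq R nat _ (fun k y => g (y - 2 * k%:R * T)) (fun k y => g' (y - 2 * k%:R * T))) => k.
  exact: is_derive_shift.
have [n xn] := large_nat (x + 1) T0.
apply: (@continuous_local _ _ (fun y => \sum_(0 <= k < n) g' (y - 2 * k%:R * T)) x 1 ltr01).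
  by move=> y; rewrite ltr_norml => /andP[y1 y2]; apply: right_sumE => //; lra.
apply: (@continuous_sum_seq R nat _ (fun k y => g' (y - 2 * k%:R * T))) => k.
exact: continuous_shift.
Qed.

(** A C^1 solution of the difference equation that agrees with b at the points
    of [-T, T] where the cut-off z is 1. It is the sum of a
    right-going sum of translates of gp and of a left-going sum of translates of
    gm; the equation for v amounts to gp(x + 2T) - gm(x) = - h(x), and the values
    of z make gp vanish on the left of -T and gm on the right of T. In [-T, T]
    one term of each sum remains. *)
Lemma extend_by_shift (R : realType) (T : R) (b z h : R -> R) : 0 < T ->
  Ck 1 b -> Ck 1 z -> Ck 1 h ->
  (forall x, x <= - T -> z x = 0) -> (forall x, T <= x -> z x = 1) ->
  exists v, [/\ Ck 1 v, forall x, v (x + 2 * T) = v x - h x &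
    forall x, - T <= x <= T -> v x = z x * b x + (1 - z x) * (b (x + 2 * T) + h x)].
Proof.
move=> T0 Cb Cz Ch z0 z1.
(* These choices give v = z b + (1 - z) (b(. + 2T) + h) on [-T, T]: near -T, v
   is the value that the equation prescribes from the values of b near T. *)
pose gp x := z x * b x - z (x - 2 * T) * (h (x - 2 * T) + b x).
pose gm x := z (x + 2 * T) * b (x + 2 * T) - z x * (h x + b (x + 2 * T)) + h x.
have gp0 x : x <= - T -> gp x = 0.
  by move=> xT; rewrite /gp !z0 ?mul0r ?subr0//; lra.
have gm0 x : x <= - T -> gm (- x) = 0.
  by move=> xT; rewrite /gm !z1; [ring|lra|lra].
have CB (f g : R -> R) : Ck 1 f -> Ck 1 g -> Ck 1 (fun x => f x - g x).
  by move=> Cf Cg; apply: CkD => //; exact: CkN.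
have Cgp : Ck 1 gp.
  apply: CB; first exact: CkM.
  by apply: CkM; [exact: Ck_shift|apply: CkD => //; exact: (Ck_shift (- (2 * T)) Ch)].
have Cgm : Ck 1 gm.
  apply: CkD => //; apply: CB; first by apply: CkM; exact: Ck_shift.
  by apply: CkM => //; apply: CkD => //; exact: Ck_shift.
exists (fun x => right_sum T gp x + right_sum T (fun y => gm (- y)) (- x)); split.
- apply: CkD; first exact: Ck_right_sum.
  apply: (@Ck_opp R 1 (right_sum T (fun y => gm (- y)))); apply: Ck_right_sum => //.
  exact: Ck_opp.
- move=> x; rewrite (right_sum_rec (x + 2 * T) T0 gp0) (right_sum_rec (- x) T0 gm0).
  have -> : - (x + 2 * T) = - x - 2 * T by lra.
  rewrite addrK opprK /gp /gm addrK; ring.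
- move=> x /andP[x1 x2]; rewrite !right_sum_id//; last lra.
  rewrite opprK /gp /gm (z0 (x - 2 * T)); last lra.
  rewrite (z1 (x + 2 * T)); last lra.
  ring.
Qed.

(** * Inputs approximating a given function on one period *)

Definition pospart (R : realType) (y : R) : R := Num.max 0 y.

Lemma Ck_pospart_sqr (R : realType) : Ck 1 (fun y : R => pospart y ^+ 2).
Proof.
exists (fun y => 2 * pospart y) => [t|]; last first.
  move=> y; apply: cvgM; first exact: cvg_cst.
  exact: (@continuous_max _ _ (cst 0) id y (@cst_continuous _ _ _ _) (@cvg_id _ (nbhs y))).
apply/is_derive_quotientP => e e0; exists e => // s st; apply: le_lt_trans.
have st0 : 0 < `|s - t| by rewrite normr_gt0 subr_eq0.
have st1 : s - t != 0 by rewrite subr_eq0.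
rewrite -(ler_pM2r st0) -normrM mulrBl mulfVK// -expr2 real_normK ?num_real// ler_norml /pospart.
by case: (leP 0 s) => s0; case: (leP 0 t) => t0; apply/andP; split; nra.
Qed.

(** A C^1 quadratic spline that rises from 0 to 1 on [0, 1]. *)
Definition ramp (R : realType) (y : R) : R :=
  2 * pospart y ^+ 2 - 4 * pospart (- 2^-1 + 1 * y) ^+ 2 + 2 * pospart (- 1 + 1 * y) ^+ 2.

Lemma ramp_le0 (R : realType) (y : R) : y <= 0 -> ramp y = 0.
Proof.
move=> y0; rewrite /ramp /pospart !(max_idPl _); first lra.
all: lra.
Qed.

Lemma ramp_ge1 (R : realType) (y : R) : 1 <= y -> ramp y = 1.
Proof.
move=> y1; rewrite /ramp /pospart !(max_idPr _); first (rewrite !mul1r; lra).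
all: lra.
Qed.

Lemma ramp_itv (R : realType) (y : R) : 0 <= ramp y <= 1.
Proof.
have [y0|y0] := leP y 0; first by rewrite ramp_le0// lexx ler01.
have [y1|y1] := leP 1 y; first by rewrite ramp_ge1// lexx ler01.
rewrite /ramp /pospart (max_idPr (ltW y0)) mul1r (max_idPl (_ : -1 + y <= 0)); last lra.
case: (leP 0 (- 2^-1 + y)) => h; apply/andP; split; nra.
Qed.

Lemma Ck_ramp (R : realType) : Ck 1 (@ramp R).
Proof.
have h := Ck_pospart_sqr R.
have h1 := @Ck_comp_affine R 1 (fun y => pospart y ^+ 2) (- 2^-1) 1 h.
have h2 := @Ck_comp_affine R 1 (fun y => pospart y ^+ 2) (- 1) 1 h.
by apply: CkD; [apply: CkD; [exact: CkZ|apply: CkN; exact: CkZ]|exact: CkZ].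
Qed.

(** Bounded convergence on an interval; the left endpoint is exempted because
    the cut-offs used below do not converge to 1 there. *)
Lemma bounded_L1_cvg (R : realType) (a b M : R) (w : nat -> R -> R) (v : R -> R) :
  (forall n, measurable_fun `[a, b] (w n)) -> measurable_fun `[a, b] v ->
  (forall x, a < x <= b -> w ^~ x @ \oo --> v x) ->
  (forall n x, a <= x <= b -> `|w n x| <= M) ->
  [/\ (@lebesgue_measure R).-integrable `[a, b] (EFin \o v),
    (\int[@lebesgue_measure R]_(x in `[a, b]) `|w n x - v x|%:E)%E @[n --> \oo] --> 0%E &
    (\int[@lebesgue_measure R]_(x in `[a, b]) (w n x)%:E)%E @[n --> \oo] -->
      (\int[@lebesgue_measure R]_(x in `[a, b]) (v x)%:E)%E].
Proof.
move=> mw mv wv wM.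
have [//|//| | | |h1 h2 h3] := @dominated_convergence _ _ R (@lebesgue_measure R) `[a, b] (measurable_itv _)
  (fun n => EFin \o w n) (EFin \o v) (EFin \o cst M).
- by move=> n; apply/measurable_EFinP; exact: mw.
- by apply/measurable_EFinP; exact: mv.
- exists [set a]; split => //; first exact: lebesgue_measure_set1.
  move=> x /= /not_implyP[]; rewrite in_itv/= => /andP[ax xb] hx.
  apply/eqP/negPn/negP => xa; apply: hx.
  apply/fine_cvgP; split; first exact: nearW.
  by apply: wv; rewrite lt_neqAle eq_sym xa ax.
- by apply: continuous_integrable_itv => y; exact: cvg_cst.
- apply/aeW => x n; rewrite /= in_itv/= => xab; rewrite lee_fin; exact: wM.
- by split.
Qed.

Lemma Ck_jump (R : realType) (T : R) (f0 fT : R -> R) : smooth f0 -> smooth fT ->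
  Ck 1 (jump T f0 fT).
Proof.
move=> f0s fTs; have C0 := smooth_Ck 1 1 f0s; have CT := smooth_Ck 1 1 fTs.
apply: CkD; first by apply: CkD => //; exact: (Ck_shift (2 * T) C0).
by apply: CkN; apply: CkZ; exact: (Ck_shift T CT).
Qed.

Lemma seq_bounded (R : realType) (u : nat -> R) (l : R) :
  u @ \oo --> l -> exists M, forall n, `|u n| <= M.
Proof.
move=> ul; have /cvg_seq_bounded [M [Mr hM]] : cvg (u @ \oo) by apply/cvg_ex; exists l.
exists (`|M| + 1) => n; apply: (hM (`|M| + 1)) => //.
by rewrite (le_lt_trans (ler_norm M))// ltrDl.
Qed.

Lemma harmonic_lt (R : realType) (d : R) : 0 < d ->
  \forall n \near \oo, n.+1%:R^-1 < d.
Proof.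
move=> d0; have /cvgrPdist_lt /(_ d d0) := @cvg_harmonic R.
apply: filterS => n; rewrite /= sub0r normrN ger0_norm//.
Qed.

(** The moving averages of w0 are C^1 and converge to w0. A cut-off that rises
    on a shorter and shorter interval to the right of -T lets them be extended
    to solutions of the difference equation, and a constant, which tends to 0,
    restores the integral over [-T, T]. *)
Lemma approx_inputs (R : realType) (T : R) (f0 fT w0 P0 : R -> R) : 0 < T ->
  smooth f0 -> smooth fT -> continuous w0 ->
  (forall x, is_derive x (1 : R) P0 (w0 x)) -> P0 T - P0 (- T) = constA T f0 fT ->
  exists w : nat -> R -> R, [/\ forall n, input_space T f0 fT (w n),
    exists M, forall n x, - T <= x <= T -> `|w n x| <= M &
    forall x, - T < x <= T -> w ^~ x @ \oo --> w0 x].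
Proof.
move=> T0 f0s fTs w0c dP0 P0A.
pose e n : R := n.+1%:R^-1.
have e0 n : 0 < e n by rewrite invr_gt0.
have e1 n : e n <= 1 by rewrite invf_le1// ler1n.
pose b n x := (P0 (x + e n) - P0 x) / e n.
(* The n-th cut-off rises from 0 at -T to 1 at -T + T / (n + 1). *)
pose z n x := @ramp R (n.+1%:R + n.+1%:R / T * x).
have zE n x : n.+1%:R + n.+1%:R / T * x = n.+1%:R * ((x + T) / T).
  by field; rewrite gt_eqF.
pose h := jump T f0 fT.
have Ch : Ck 1 h by exact: Ck_jump.
have CP0 : Ck 1 P0 by exists w0.
have Cb n : Ck 1 (b n).
  have -> : b n = (fun x => (e n)^-1 * (P0 (x + e n) - P0 x)).
    by apply/funext => x; rewrite /b mulrC.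
  by apply: CkZ; apply: CkD; [exact: Ck_shift|exact: CkN].
have Cz n : Ck 1 (z n) by apply: Ck_comp_affine; exact: Ck_ramp.
have n1 n : (1 : R) <= n.+1%:R by rewrite ler1n.
have z0 n x : x <= - T -> z n x = 0.
  move=> xT; rewrite /z ramp_le0// zE; apply: mulr_ge0_le0; first exact: ler0n.
  by rewrite pmulr_lle0 ?invr_gt0//; lra.
have z1 n x : T <= x -> z n x = 1.
  move=> xT; rewrite /z ramp_ge1// zE; have : 1 <= (x + T) / T by rewrite ler_pdivlMr//; lra.
  have := n1 n; nra.
have z1lim x : - T < x -> \forall n \near \oo, z n x = 1.
  move=> xT; have d0 : 0 < (x + T) / T by rewrite divr_gt0//; lra.
  have := harmonic_lt d0; apply: filterS => n /ltW hn.
  by rewrite /z ramp_ge1// zE mulrC -ler_pdivrMr// div1r.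
have b_cvg x : b ^~ x @ \oo --> w0 x.
  apply/cvgrPdist_lt => eps eps0; have /is_derive_quotientP /(_ eps eps0) [d d0 hd] := dP0 x.
  have := harmonic_lt d0; apply: filterS => n hn; rewrite distrC.
  have := hd (x + e n); rewrite addrAC subrr add0r; apply.
    by rewrite -subr_eq0 addrAC subrr add0r gt_eqF.
  by rewrite gtr0_norm.
have [M M0 hM] := continuous_bounded_itv (- T - 1) (3 * T + 1) w0c.
have bM n x : - T <= x <= 3 * T -> `|b n x| <= M.
  move=> /andP[x1 x2]; rewrite /b; have [c [cx ->]] := mvt_between x (x + e n) dP0.
  have -> : w0 c * (x + e n - x) / e n = w0 c by field; rewrite gt_eqF.
  apply: hM; move: cx; rewrite addrAC subrr add0r (gtr0_norm (e0 n)) ler_norml => /andP[c1 c2].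
  have := e1 n; have := e0 n; lra.
have [Mh Mh0 hMh] := continuous_bounded_itv (- T) T (Ck_continuous Ch).
(* The values on [-T, T] of the extension of b n. *)
pose s n x := z n x * b n x + (1 - z n x) * (b n (x + 2 * T) + h x).
have sM n x : - T <= x <= T -> `|s n x| <= M + (M + Mh).
  move=> xT; have /andP[zz0 zz1] : 0 <= z n x <= 1 by exact: ramp_itv.
  have h1 : `|b n x| <= M by apply: bM; lra.
  have h2 : `|b n (x + 2 * T) + h x| <= M + Mh.
    by apply: le_trans (ler_normD _ _) _; apply: lerD; [apply: bM; lra|exact: hMh].
  apply: le_trans (ler_normD _ _) _; have zz2 : 0 <= 1 - z n x by lra.
  rewrite (normrM (z n x)) (normrM (1 - z n x)) (ger0_norm zz0) (ger0_norm zz2).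
  have := normr_ge0 (b n x); have := normr_ge0 (b n (x + 2 * T) + h x); nra.
have s_cvg x : - T < x <= T -> s ^~ x @ \oo --> w0 x.
  move=> /andP[x1 _]; apply: cvg_trans (b_cvg x); apply: near_eq_cvg.
  have := z1lim x x1; apply: filterS => n zn.
  by rewrite /s zn mul1r subrr mul0r addr0.
have sc n : continuous (s n).
  have Cbs : Ck 1 (fun x => b n (x + 2 * T)) by exact: Ck_shift.
  have C1z : Ck 1 (fun x => 1 - z n x) by apply: CkD; [exact: Ck_cst|exact: CkN].
  apply: (@Ck_continuous _ 1); apply: CkD; first exact: CkM.
  by apply: CkM => //; exact: CkD.
have [S dS] : {S : nat -> R -> R & forall n x, is_derive x (1 : R) (S n) (s n x)}.
  apply: (@boolp.choice nat (R -> R) (fun n Sn => forall x, is_derive x (1 : R) Sn (s n x))).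
  by move=> n; exact: continuous_primitive.
(* Adding the constant c n to b n adds it to s n as well, since the weights z and
   1 - z have sum 1. *)
pose c n := (constA T f0 fT - (S n T - S n (- T))) / (2 * T).
have TT : - T <= T by lra.
have c_cvg : c @ \oo --> 0.
  have [_ _] := bounded_L1_cvg (fun n => measurable_funTS (continuous_measurable_fun (sc n)))
     (measurable_funTS (continuous_measurable_fun w0c)) s_cvg sM.
  rewrite (integral_FTC2 TT w0c dP0) P0A.
  under eq_fun do rewrite (integral_FTC2 TT (sc _) (dS _)).
  move=> /fine_cvgP[_] /= hS.
  have -> : (0 : R) = (constA T f0 fT - constA T f0 fT) / (2 * T) by rewrite subrr mul0r.
  apply: cvgM; last exact: cvg_cst.
  by apply: cvgB; [exact: cvg_cst|exact: hS].
have H n : exists v, [/\ Ck 1 v, forall x, v (x + 2 * T) = v x - h x &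
    forall x, - T <= x <= T -> v x = s n x + c n].
  have Cbc : Ck 1 (fun x => b n x + c n) by apply: CkD => //; exact: Ck_cst.
  have [v [Cv vs vE]] := extend_by_shift T0 Cbc (Cz n) Ch (z0 n) (z1 n).
  by exists v; split => // x xT; rewrite vE// /s; ring.
have [w hw] := @boolp.choice nat (R -> R) _ H.
exists w; split.
- move=> n; have [Cw ws wE] := hw n.
  have [V dV] := continuous_primitive (Ck_continuous Cw).
  apply: (input_space_of_shift T0 f0s fTs Cw dV ws); apply: EFin_inj.
  rewrite -(integral_FTC2 TT (Ck_continuous Cw) dV).
  have dSc x : is_derive x (1 : R) (fun x => S n x + (0 + c n * x)) (s n x + c n).
    by apply: is_derive_addf => //; exact: is_derive_affine.
  have scc : continuous (fun x => s n x + c n).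
    by move=> x; apply: cvgD; [exact: sc|exact: cvg_cst].
  transitivity (\int[@lebesgue_measure R]_(x in `[(- T)%R, T]) (s n x + c n)%:E)%E.
    by apply: eq_integral => x; rewrite inE/= in_itv/= => xT; rewrite wE.
  rewrite (integral_FTC2 TT scc dSc) /c; congr (_%:E); field; lra.
- have [Mc hMc] := seq_bounded c_cvg.
  exists (M + (M + Mh) + Mc) => n x xT; have [_ _ wE] := hw n; rewrite wE//.
  by apply: le_trans (ler_normD _ _) _; apply: lerD; [exact: sM|exact: hMc].
- move=> x xT; have -> : w ^~ x = (fun n => s n x + c n).
    by apply/funext => n; have [_ _ wE] := hw n; rewrite wE//; lra.
  by rewrite -[w0 x]addr0; apply: cvgD => //; exact: s_cvg.
Qed.

(** * The excess of an input over the optimal cost *)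

Lemma continuous_pospart (R : realType) (f : R -> R) :
  continuous f -> continuous (fun x => pospart (f x)).
Proof.
move=> fc x; exact: (@continuous_max _ _ (cst 0) f x (@cst_continuous _ _ _ _) (fc x)).
Qed.

Lemma continuous_t_fun (R : realType) (T : R) (f0 fT : R -> R) (K2 i : nat) :
  smooth f0 -> smooth fT -> continuous (t_fun T f0 fT K2 i).
Proof.
move=> f0s fTs.
have shifted (f : R -> R) (k : nat) (a : nat -> R) : smooth f ->
    continuous (fun x => \sum_(0 <= n < k) derive1 f (x + a n)).
  move=> fs; apply: (@continuous_sum_seq R nat _ (fun n x => derive1 f (x + a n))) => n.
  by apply: continuous_shift; exact: (smooth_Ck 0 1 fs).
have c0 a : continuous (fun x => derive1 f0 (x + a)).
  by apply: continuous_shift; exact: (smooth_Ck 0 1 f0s).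
have c00 : continuous (derive1 f0) by exact: (smooth_Ck 0 1 f0s).
rewrite /t_fun; case: (i <= 1)%N; first by move=> x; exact: cvg_cst.
case: (i <= K2.+1)%N => x; rewrite /t_right /t_left.
  have s0 := shifted f0 i.-1 (fun n => (2 * i.-1%:R - 2 * n%:R) * T) f0s x.
  have sT := shifted fT i.-1 (fun n => (2 * i.-1%:R - 2 * n%:R - 1) * T) fTs x.
  apply: cvgB; last exact: c0.
  apply: cvgB; last by apply: cvgM; [exact: cvg_cst|exact: sT].
  by apply: cvgD; [exact: c00|apply: cvgM; [exact: cvg_cst|exact: s0]].
have sT := shifted fT (i - K2.+1)%N (fun n => (2 * n%:R + 1 - 2 * (i - K2.+1)%:R) * T) fTs x.
have s0 := shifted f0 (i - K2.+1)%N (fun n => 2 * (n%:R + 1 - (i - K2.+1)%:R) * T) f0s x.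
apply: cvgB; last exact: c0.
apply: cvgB; last by apply: cvgM; [exact: cvg_cst|exact: s0].
by apply: cvgD; [exact: c00|apply: cvgM; [exact: cvg_cst|exact: sT]].
Qed.

Section Levels.
Variables (R : realType) (T : R) (f0 fT : R -> R) (K1 K2 : nat).
Local Notation K := (K1 + K2 + 1)%N.

(** The function a_(i+1), as a real function: indices start from 0, so that
    level i is preceded by i levels that are at least as large. *)
Definition level (i : nat) (x : R) : R :=
  nth 0 (dsort [seq t_fun T f0 fT K2 k x | k <- iota 1 K]) i.

(** The value s lies below the j largest of the t_k(x) and above the others,
    that is a_(j+1)(x) <= s <= a_j(x) with the infinite conventions. *)
Definition between (j : nat) (x s : R) : Prop :=
  (forall i, (i < j)%N -> s <= level i x) /\
  (forall i, (j <= i < K)%N -> level i x <= s).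

(** How much the cost of s exceeds its affine minorant of slope K - 2j. It
    vanishes exactly when s is between the levels, and it is Lipschitz in s,
    which is all that is needed to pass to L^1 limits. *)
Definition excess (j : nat) (x s : R) : R :=
  2 * \sum_(0 <= i < K) (if (i < j)%N then pospart (s - level i x)
                         else pospart (level i x - s)).

Lemma level_anti (i j : nat) (x : R) : (i <= j < K)%N -> level j x <= level i x.
Proof. by move=> ijK; apply: dsort_anti; rewrite size_map size_iota. Qed.

Lemma between_level (i j : nat) (x : R) : (i < K)%N -> (j = i \/ j = i.+1) ->
  between j x (level i x).
Proof.
move=> iK [->|->]; split=> k.
- by move=> ki; apply: level_anti; rewrite iK ltnW.
- by move=> /andP[ik kK]; apply: level_anti; rewrite ik.
- by rewrite ltnS => ki; apply: level_anti; rewrite ki.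
- by move=> /andP[ik kK]; apply: level_anti; rewrite ltnW.
Qed.

(** The affine minorant touches the cost at every point between the levels. *)
Lemma cost_excess (j : nat) (x w s : R) : (j <= K)%N -> between j x w ->
  cost T f0 fT K1 K2 x s = cost T f0 fT K1 K2 x w +
    (K%:R - 2 * j%:R) * (s - w) + excess j x s.
Proof.
move=> jK [h1 h2].
have E (c : R) : cost T f0 fT K1 K2 x c =
    \sum_(y <- [seq t_fun T f0 fT K2 k x | k <- iota 1 K]) `|c - y|.
  by rewrite big_map.
by rewrite !E (cost_gap (j := j) (w := w)) ?size_map ?size_iota.
Qed.

Lemma pospart_ge0 (y : R) : 0 <= pospart y.
Proof. by rewrite /pospart le_max lexx. Qed.

Lemma excess_ge0 (j : nat) (x s : R) : 0 <= excess j x s.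
Proof.
by rewrite mulr_ge0//; apply: sumr_ge0 => i _; case: ifP => _; exact: pospart_ge0.
Qed.

Lemma pospart_lip (y z : R) : pospart y <= pospart z + `|y - z|.
Proof.
have := ler_norm (y - z); have := normr_ge0 (y - z); rewrite /pospart.
by case: (leP 0 y); case: (leP 0 z); lra.
Qed.

Lemma excess_lip (j : nat) (x s r : R) :
  excess j x s <= excess j x r + 2 * K%:R * `|s - r|.
Proof.
rewrite /excess -mulrA -mulrDr ler_pM2l//.
have -> : K%:R * `|s - r| = \sum_(0 <= i < K) `|s - r|.
  by rewrite sumr_const_nat subn0 mulr_natl.
rewrite -big_split/=; apply: ler_sum => i _; case: ifP => _.
- by apply: le_trans (pospart_lip _ (r - level i x)) _; rewrite opprB addrA subrK.
- apply: le_trans (pospart_lip _ (level i x - r)) _.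
  by rewrite (_ : _ - _ - _ = r - s); [rewrite distrC|ring].
Qed.

Lemma excess0P (j : nat) (x s : R) : (j <= K)%N -> excess j x s = 0 <-> between j x s.
Proof.
move=> jK; have pp y : (pospart y = 0) <-> y <= 0.
  by rewrite /pospart; split; [move=> h; rewrite -h le_max lexx orbT|exact: max_idPl].
rewrite /excess big_mkord; split=> [/eqP|[h1 h2]].
  rewrite mulf_eq0 pnatr_eq0/= psumr_eq0; last first.
    by move=> i _; case: ifP => _; exact: pospart_ge0.
  move=> /allP h; split=> i.
    move=> ij; have iK : (i < K)%N by exact: leq_trans jK.
    have := h (Ordinal iK) (mem_index_enum _); rewrite /= ij => /eqP /pp; lra.
  move=> /andP[ji iK]; have := h (Ordinal iK) (mem_index_enum _).
  rewrite /= ltnNge ji /= => /eqP /pp; lra.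
rewrite big1 ?mulr0// => i _; case: ifPn => [ij|]; last rewrite -leqNgt => ij.
- by apply/pp; have := h1 i ij; lra.
- by apply/pp; have := h2 i; rewrite ij ltn_ord => /(_ isT); lra.
Qed.

End Levels.

Lemma continuous_level (R : realType) (T : R) (f0 fT : R -> R) (K1 K2 i : nat) :
  smooth f0 -> smooth fT -> continuous (level T f0 fT K1 K2 i).
Proof.
move=> f0s fTs; have [iK|iK] := ltnP i (K1 + K2 + 1).
  apply: (@continuous_dsort R nat (iota 1 (K1 + K2 + 1)) (fun k x => t_fun T f0 fT K2 k x)).
    by rewrite size_iota.
  by move=> k; exact: continuous_t_fun.
have -> : level T f0 fT K1 K2 i = fun=> 0.
  by apply/funext => x; rewrite /level nth_default// size_sort size_map size_iota.
by move=> x; exact: cvg_cst.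
Qed.

Lemma continuous_excess (R : realType) (T : R) (f0 fT v : R -> R) (K1 K2 j : nat) :
  smooth f0 -> smooth fT -> continuous v ->
  continuous (fun x => excess T f0 fT K1 K2 j x (v x)).
Proof.
move=> f0s fTs vc x; apply: cvgM; first exact: cvg_cst.
apply: (@continuous_sum_seq R nat _ (fun i x => if (i < j)%N
  then pospart (v x - level T f0 fT K1 K2 i x) else pospart (level T f0 fT K1 K2 i x - v x))) => i.
have lc := @continuous_level R T f0 fT K1 K2 i f0s fTs.
by case: (i < j)%N; apply: continuous_pospart => y; apply: cvgB;
  [exact: vc|exact: lc|exact: lc|exact: vc].
Qed.

Lemma measurable_excess (R : realType) (T : R) (f0 fT v : R -> R) (K1 K2 j : nat) (D : set R) :
  smooth f0 -> smooth fT -> measurable D -> measurable_fun D v ->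
  measurable_fun D (fun x => excess T f0 fT K1 K2 j x (v x)).
Proof.
move=> f0s fTs mD mv; apply: measurable_funM => //.
under eq_fun do rewrite big_mkord.
apply: measurable_sum => i.
have ml : measurable_fun D (level T f0 fT K1 K2 i).
  exact: (measurable_funTS (continuous_measurable_fun (continuous_level f0s fTs))).
by case: (i < j)%N; apply: measurable_maxr => //; apply: measurable_funB.
Qed.

Lemma continuous_cost (R : realType) (T : R) (f0 fT v : R -> R) (K1 K2 : nat) :
  smooth f0 -> smooth fT -> continuous v ->
  continuous (fun x => cost T f0 fT K1 K2 x (v x)).
Proof.
move=> f0s fTs vc.
apply: (@continuous_sum_seq R nat _ (fun i x => `|v x - t_fun T f0 fT K2 i x|)) => i.
apply: continuous_abs => x; apply: cvgB; first exact: vc.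
exact: continuous_t_fun.
Qed.

(** * The infimum of the norms and its approximation *)

Lemma ereal_le_vanishing (R : realType) (x y : \bar R) (u : nat -> \bar R) :
  u @ \oo --> 0%E -> (forall n, (x <= y + u n)%E) -> (x <= y)%E.
Proof.
move=> /fine_cvgP[ufin u0] h; apply/lee_addgt0Pr => e e0.
have /cvgrPdist_lt /(_ e e0) := u0 => ue.
near \oo => n.
apply: le_trans (h n) _; apply: leeD2l.
have un : u n \is a fin_num by near: n.
have : `|0 - (fine \o u) n| < e by near: n.
rewrite sub0r normrN /= => /ltr_normlW hn.
by rewrite -(fineK un) lee_fin ltW.
Unshelve. all: end_near.
Qed.

Lemma L1norm_triangle (R : realType) (D : set R) (f g : R -> R) : measurable D ->
  measurable_fun D f -> measurable_fun D g ->
  (L1norm D f <= L1norm D g + L1norm D (fun x => (f x - g x)%R))%E.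
Proof.
move=> mD mf mg; rewrite /L1norm -ge0_integralD//.
- apply: ge0_le_integral => //.
  + by apply/measurable_EFinP; exact: measurableT_comp.
  + apply: emeasurable_funD; apply/measurable_EFinP; apply: measurableT_comp => //.
    exact: measurable_funB.
  + by move=> x _; rewrite -EFinD lee_fin -{1}(subrKC (g x) (f x)) ler_normD.
- by apply/measurable_EFinP; exact: measurableT_comp.
- by apply/measurable_EFinP; apply: measurableT_comp => //; exact: measurable_funB.
Qed.

Lemma periodicZ (R : realType) (p : R) (d : R -> R) (m : int) (x : R) :
  (forall x, d (x + p) = d x) -> d (x + m%:~R * p) = d x.
Proof.
move=> dp; have H n y : d (y + n%:R * p) = d y.
  elim: n y => [|n IH] y; first by rewrite mul0r addr0.
  by rewrite -natr1 mulrDl mul1r addrA dp IH.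
case: m => n; first exact: H.
rewrite NegzE mulrNz -(H n.+1 (x + _)); congr d; rewrite -addrA -mulrDl.
by rewrite addNr mul0r addr0.
Qed.

(** The representative of x modulo 2T in the half-open interval from -T
    (excluded) to T. *)
Definition rep (R : realType) (T x : R) : R :=
  x + (Num.floor ((T - x) / (2 * T)))%:~R * (2 * T).

Lemma rep_itv (R : realType) (T x : R) : 0 < T -> - T < rep T x <= T.
Proof.
move=> T0; have := floor_itv ((T - x) / (2 * T)); rewrite intrD /rep.
set m := (_%:~R : R); rewrite ler_pdivlMr ?ltr_pdivrMr ?mulr_gt0// => /andP[h1 h2].
lra.
Qed.

Lemma input_space_continuous (R : realType) (T : R) (f0 fT v : R -> R) :
  0 < T -> smooth f0 -> smooth fT -> input_space T f0 fT v -> continuous v.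
Proof. by move=> T0 f0s fTs /(input_space_elim T0 f0s fTs)[]. Qed.

(** Integrating the expansion of the cost at w0: the linear term is K - 2j times
    the difference of the integrals of v and w0 over [-T, T], both equal to A. *)
Lemma input_norm (R : realType) (T : R) (f0 fT w0 P0 : R -> R) (K1 K2 j : nat) :
  0 < T -> smooth f0 -> smooth fT -> (j <= K1 + K2 + 1)%N ->
  continuous w0 -> (forall x, is_derive x (1 : R) P0 (w0 x)) ->
  P0 T - P0 (- T) = constA T f0 fT ->
  (forall x, - T <= x <= T -> between T f0 fT K1 K2 j x (w0 x)) ->
  exists N : R, forall v, input_space T f0 fT v ->
    L1norm (window T K1 K2) v = (N%:E + \int[@lebesgue_measure R]_(x in `[(- T)%R, T])
       (excess T f0 fT K1 K2 j x (v x))%:E)%E.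
Proof.
move=> T0 f0s fTs jK w0c dP0 P0A bet.
have TT : - T <= T by lra.
have [C dC] := continuous_primitive (@continuous_cost R T f0 fT w0 K1 K2 f0s fTs w0c).
exists (C T - C (- T)) => v vin.
have [vc vs vA] := input_space_elim T0 f0s fTs vin.
have [V dV] := continuous_primitive vc.
have ec := @continuous_excess R T f0 fT v K1 K2 j f0s fTs vc.
have [E dE] := continuous_primitive ec.
rewrite (L1norm_window K1 K2 T0 vc vs) (integral_FTC2 TT ec dE).
pose k : R := (K1 + K2 + 1)%:R - 2 * j%:R.
have dG x : is_derive x (1 : R) (fun x => C x + k * (V x - P0 x) + E x)
    (cost T f0 fT K1 K2 x (w0 x) + k * (v x - w0 x) + excess T f0 fT K1 K2 j x (v x)).
  have h := is_derive_mulcf k (is_derive_subf (dV x) (dP0 x)).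
  exact: is_derive_addf (is_derive_addf (dC x) h) (dE x).
have gc : continuous (fun x => cost T f0 fT K1 K2 x (w0 x) + k * (v x - w0 x) +
    excess T f0 fT K1 K2 j x (v x)).
  have cc := @continuous_cost R T f0 fT w0 K1 K2 f0s fTs w0c.
  move=> x; apply: cvgD; last exact: ec.
  apply: cvgD; first exact: cc.
  by apply: cvgM; [exact: cvg_cst|apply: cvgB; [exact: vc|exact: w0c]].
transitivity (\int[@lebesgue_measure R]_(x in `[(- T)%R, T])
   (cost T f0 fT K1 K2 x (w0 x) + k * (v x - w0 x) + excess T f0 fT K1 K2 j x (v x))%:E)%E.
  apply: eq_integral => x; rewrite inE/= in_itv/= => xT; congr (_%:E).
  by apply: cost_excess => //; exact: bet.
rewrite (integral_FTC2 TT gc dG) -EFinD; congr (_%:E).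
have := vA V dV; nra.
Qed.

Lemma measurable_cont (R : realType) (D : set R) (f : R -> R) :
  continuous f -> measurable_fun D f.
Proof. by move=> fc; apply: measurable_funTS; exact: continuous_measurable_fun. Qed.

Lemma L1_distC (R : realType) (D : set R) (f g : R -> R) :
  L1norm D (fun x => f x - g x) = L1norm D (fun x => g x - f x).
Proof. by rewrite /L1norm; apply: eq_integral => x _; rewrite distrC. Qed.

Lemma L1norm_subset (R : realType) (A D : set R) (f : R -> R) :
  measurable A -> measurable D -> measurable_fun D f -> A `<=` D ->
  (L1norm A f <= L1norm D f)%E.
Proof.
move=> mA mD mf AD; apply: ge0_subset_integral => //.
by apply/measurable_EFinP; exact: measurableT_comp.
Qed.

Lemma excess_integral_lip (R : realType) (T : R) (f0 fT v w : R -> R) (K1 K2 j : nat) :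
  smooth f0 -> smooth fT ->
  measurable_fun `[(- T)%R, T] v -> measurable_fun `[(- T)%R, T] w ->
  (\int[@lebesgue_measure R]_(x in `[(- T)%R, T]) (excess T f0 fT K1 K2 j x (v x))%:E <=
   \int[@lebesgue_measure R]_(x in `[(- T)%R, T]) (excess T f0 fT K1 K2 j x (w x))%:E +
   (2 * (K1 + K2 + 1)%:R)%:E * L1norm `[(- T)%R, T] (fun x => (v x - w x)%R))%E.
Proof.
move=> f0s fTs mv mw.
have mvw : measurable_fun `[(- T)%R, T] (fun x => `|v x - w x|%:E).
  by apply/measurable_EFinP; apply: measurableT_comp => //; exact: measurable_funB.
have mev := @measurable_excess R T f0 fT v K1 K2 j _ f0s fTs (measurable_itv _) mv.
have mew := @measurable_excess R T f0 fT w K1 K2 j _ f0s fTs (measurable_itv _) mw.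
rewrite /L1norm -ge0_integralZl_EFin// -?ge0_integralD//.
- apply: ge0_le_integral => //.
  + by move=> x _; rewrite lee_fin excess_ge0.
  + exact/measurable_EFinP.
  + apply: emeasurable_funD; first exact/measurable_EFinP.
    exact: measurable_funeM.
  + by move=> x _; rewrite -EFinM -EFinD lee_fin excess_lip.
- by move=> x _; rewrite lee_fin excess_ge0.
- exact/measurable_EFinP.
- exact: measurable_funeM.
Qed.

Lemma cvg_mule0 (R : realType) (c : R) (u : nat -> \bar R) :
  u @ \oo --> 0%E -> (fun n => (c%:E * u n)%E) @ \oo --> 0%E.
Proof.
move=> u0; have -> : (0 : \bar R) = (c%:E * 0)%E by rewrite mule0.
exact: cvgeZl.
Qed.

(** The difference of two inputs has period 2T. Hence the convergence of the
    inputs to w0 on one period propagates to the whole line, and their limit is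
    an input plus the periodic extension of the difference on one period. The
    convergence of the excess follows from its Lipschitz bound. *)
Lemma optimal_limit (R : realType) (T : R) (f0 fT w0 P0 : R -> R) (K1 K2 j : nat) :
  0 < T -> smooth f0 -> smooth fT -> (j <= K1 + K2 + 1)%N ->
  continuous w0 -> (forall x, is_derive x (1 : R) P0 (w0 x)) ->
  P0 T - P0 (- T) = constA T f0 fT ->
  (forall x, - T <= x <= T -> between T f0 fT K1 K2 j x (w0 x)) ->
  exists (w : nat -> R -> R) (W0 : R -> R),
    [/\ forall n, input_space T f0 fT (w n), L1_cvg (window T K1 K2) w W0 &
      (\int[@lebesgue_measure R]_(x in `[(- T)%R, T])
         (excess T f0 fT K1 K2 j x (w n x))%:E)%E @[n --> \oo] --> 0%E].
Proof.
move=> T0 f0s fTs jK w0c dP0 P0A bet.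
have [w [win [M hM] wcvg]] := approx_inputs T0 f0s fTs w0c dP0 P0A.
have wc n : continuous (w n) by exact: input_space_continuous T0 f0s fTs (win n).
(* By periodicity w n - W0 at x equals w n - w0 at the representative of x. *)
pose W0 x := w 0%N x + (w0 (rep T x) - w 0%N (rep T x)).
have wW n x : w n x - W0 x = w n (rep T x) - w0 (rep T x).
  have H : forall y, (w n (y + 2 * T) - w 0%N (y + 2 * T)) = w n y - w 0%N y.
    move=> y; have [_ h1 _] := input_space_elim T0 f0s fTs (win n).
    by have [_ h2 _] := input_space_elim T0 f0s fTs (win 0%N); rewrite h1 h2; ring.
  have := periodicZ (Num.floor ((T - x) / (2 * T))) x H; rewrite -/(rep T x) /W0; lra.
have wcvgW x : w ^~ x @ \oo --> W0 x.
  have h := wcvg (rep T x) (rep_itv x T0).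
  have -> : w ^~ x = (fun n => w n (rep T x) + (W0 x - w0 (rep T x))).
    by apply/funext => n; have := wW n x; lra.
  have -> : nbhs (W0 x) = nbhs (w0 (rep T x) + (W0 x - w0 (rep T x))) by rewrite subrKC.
  by apply: cvgD => //; exact: cvg_cst.
have [M1 _ hM1] := continuous_bounded_itv (- ((2 * K1%:R + 1) * T)) ((2 * K2%:R + 1) * T) (wc 0%N).
have wM n x : - ((2 * K1%:R + 1) * T) <= x <= (2 * K2%:R + 1) * T -> `|w n x| <= M1 + (M + M).
  move=> xw; have /andP[r1 r2] := rep_itv x T0.
  have rT : - T <= rep T x <= T by rewrite ltW.
  have -> : w n x = w 0%N x + (w n (rep T x) - w 0%N (rep T x)).
    by have := wW n x; have := wW 0%N x; lra.
  apply: le_trans (ler_normD _ _) _; apply: lerD; first exact: hM1.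
  by apply: le_trans (ler_normB _ _) _; apply: lerD; exact: hM.
have mW D : measurable_fun D W0.
  by apply: (measurable_fun_cvg (h := w)) => // n; exact: measurable_cont.
have [iW cW _] := bounded_L1_cvg (fun n => measurable_cont (wc n)) (mW _) (fun x _ => wcvgW x) wM.
have [_ c0 _] := bounded_L1_cvg (fun n => measurable_cont (wc n)) (measurable_cont w0c) wcvg hM.
exists w, W0; split => //.
have e0 : (\int[@lebesgue_measure R]_(x in `[(- T)%R, T]) (excess T f0 fT K1 K2 j x (w0 x))%:E = 0)%E.
  rewrite -[RHS](integral0 (@lebesgue_measure R) `[(- T)%R, T]).
  apply: eq_integral => x; rewrite inE/= in_itv/= => xT; congr (_%:E).
  by apply/excess0P => //; exact: bet.
have h := @cvg_mule0 R (2 * (K1 + K2 + 1)%:R) _ c0.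
apply: (squeeze_cvge _ (@cvg_cst _ (0%E : \bar R) _ \oo _) h).
apply: nearW => n; apply/andP; split.
  by apply: integral_ge0 => x _; rewrite lee_fin excess_ge0.
have := @excess_integral_lip R T f0 fT (w n) w0 K1 K2 j f0s fTs (measurable_cont (wc n)) (measurable_cont w0c).
by rewrite e0 add0e.
Qed.

Lemma inf_norm (R : realType) (T : R) (f0 fT : R -> R) (K1 K2 j : nat) (N : R)
    (w : nat -> R -> R) :
  (forall v, input_space T f0 fT v ->
    L1norm (window T K1 K2) v = (N%:E + \int[@lebesgue_measure R]_(x in `[(- T)%R, T])
       (excess T f0 fT K1 K2 j x (v x))%:E)%E) ->
  (forall n, input_space T f0 fT (w n)) ->
  (\int[@lebesgue_measure R]_(x in `[(- T)%R, T])
         (excess T f0 fT K1 K2 j x (w n x))%:E)%E @[n --> \oo] --> 0%E ->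
  ereal_inf [set L1norm (window T K1 K2) v | v in input_space T f0 fT] = N%:E.
Proof.
move=> hN win we; apply/eqP; rewrite eq_le; apply/andP; split.
  apply: (ereal_le_vanishing we) => n; rewrite -hN//.
  by apply: ereal_inf_lbound; exists (w n).
apply: le_ereal_inf_tmp => _ [v vin <-]; rewrite hN// leeDl//.
by apply: integral_ge0 => x _; rewrite lee_fin excess_ge0.
Qed.

Lemma subset_window (R : realType) (T : R) (K1 K2 : nat) : 0 < T ->
  `[(- T)%R, T] `<=` window T K1 K2.
Proof.
move=> T0 x; rewrite /window /= !in_itv/= => /andP[x1 x2].
have : 0 <= K1%:R * T by rewrite mulr_ge0// ltW.
have : 0 <= K2%:R * T by rewrite mulr_ge0// ltW.
move=> h1 h2; apply/andP; split; lra.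
Qed.

Lemma measurable_of_integrable (R : realType) (D : set R) (v : R -> R) :
  (@lebesgue_measure R).-integrable D (EFin \o v) -> measurable_fun D v.
Proof. by move=> /integrableP[/measurable_EFinP]. Qed.

Lemma excess_integral_ge0 (R : realType) (T : R) (f0 fT v : R -> R) (K1 K2 j : nat) :
  (0 <= \int[@lebesgue_measure R]_(x in `[(- T)%R, T])
    (excess T f0 fT K1 K2 j x (v x))%:E)%E.
Proof. by apply: integral_ge0 => x _; rewrite lee_fin excess_ge0. Qed.

Section OptimalInput.
Variables (R : realType) (T : R) (f0 fT w0 P0 : R -> R) (K1 K2 j : nat).
Hypotheses (T0 : 0 < T) (f0s : smooth f0) (fTs : smooth fT).
Hypothesis jK : (j <= K1 + K2 + 1)%N.
Hypothesis w0c : continuous w0.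
Hypothesis dP0 : forall x, is_derive x (1 : R) P0 (w0 x).
Hypothesis P0A : P0 T - P0 (- T) = constA T f0 fT.
Hypothesis bet : forall x, - T <= x <= T -> between T f0 fT K1 K2 j x (w0 x).

(** The approximating inputs have norm N plus an excess integral that tends to
    0, and norms pass to L^1 limits, so their limit has norm N. *)
Lemma pms_exists : exists u, is_PMS T f0 fT K1 K2 u.
Proof.
have [N hN] := input_norm T0 f0s fTs jK w0c dP0 P0A bet.
have [w [W0 [win [iW cW] we]]] := optimal_limit T0 f0s fTs jK w0c dP0 P0A bet.
have infN := inf_norm hN win we.
have [u hu] : {u : nat -> R -> R -> R & forall n, is_solution T f0 fT (u n) /\ w n = input T (u n)}.
  apply: (@boolp.choice nat (R -> R -> R) (fun n un => is_solution T f0 fT un /\ w n = input T un)).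
  by move=> n; have [un su wu] := win n; exists un.
have wu : (fun n => input T (u n)) = w by apply/funext => n; case: (hu n).
exists u; split; first by move=> n; case: (hu n).
exists W0; first by rewrite wu; split.
have mw n : measurable_fun (window T K1 K2) (w n).
  by apply: measurable_cont; exact: input_space_continuous T0 f0s fTs (win n).
have mW := measurable_of_integrable iW.
rewrite infN; apply/eqP; rewrite eq_le; apply/andP; split.
- have h : (fun n => (\int[@lebesgue_measure R]_(x in `[(- T)%R, T])
         (excess T f0 fT K1 K2 j x (w n x))%:E +
       L1norm (window T K1 K2) (fun x => (w n x - W0 x)%R))%E) @ \oo --> 0%E.
    by rewrite -[0%E]adde0; apply: cvgeD.
  apply: (ereal_le_vanishing h) => n.
  by rewrite addeA -hN// (L1_distC _ (w n)); apply: L1norm_triangle => //; exact: measurable_itv.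
- apply: (ereal_le_vanishing cW) => n.
  apply: le_trans (L1norm_triangle _ (mw n) mW); last exact: measurable_itv.
  by rewrite hN// leeDl//; exact: excess_integral_ge0.
Qed.

(** The norms of the inputs of a pre-minimum-input solution tend to the infimum
    N, so their excess integrals tend to 0, and by the Lipschitz bound the excess
    of the limit v has integral 0. A nonnegative function with integral 0
    vanishes almost everywhere. *)
Lemma pms_limit_between (u : nat -> R -> R -> R) (v : R -> R) :
  is_PMS T f0 fT K1 K2 u ->
  L1_cvg (window T K1 K2) (fun n => input T (u n)) v ->
  {ae @lebesgue_measure R, forall x, - T <= x <= T -> between T f0 fT K1 K2 j x (v x)}.
Proof.
move=> [su [v' [iv' cv'] nv']] [iv cv].
have [N hN] := input_norm T0 f0s fTs jK w0c dP0 P0A bet.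
have [w [W0 [win [iW cW] we]]] := optimal_limit T0 f0s fTs jK w0c dP0 P0A bet.
rewrite (inf_norm hN win we) in nv' => {w W0 win iW cW we}.
pose w n := input T (u n).
have win n : input_space T f0 fT (w n) by exists (u n).
have mwin : measurable (window T K1 K2) by exact: measurable_itv.
have mw n D : measurable_fun D (w n).
  by apply: measurable_cont; exact: input_space_continuous T0 f0s fTs (win n).
have mv := measurable_of_integrable iv; have mv' := measurable_of_integrable iv'.
have sw := @subset_window R T K1 K2 T0.
have mvT : measurable_fun `[(- T)%R, T] v by exact: measurable_funS mv.
have exle n : (\int[@lebesgue_measure R]_(x in `[(- T)%R, T])
    (excess T f0 fT K1 K2 j x (w n x))%:E <=
    L1norm (window T K1 K2) (fun x => (w n x - v' x)%R))%E.
  (* The finite number N cancels: N + excess of w n = norm of w n, and N is the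
     norm of v'. *)
  rewrite -(leeD2lE (x := N%:E))// -hN// -nv'.
  exact: L1norm_triangle.
have ex0 : (\int[@lebesgue_measure R]_(x in `[(- T)%R, T])
    (excess T f0 fT K1 K2 j x (v x))%:E = 0)%E.
  apply/eqP; rewrite eq_le excess_integral_ge0 andbT.
  have h : (fun n => (L1norm (window T K1 K2) (fun x => (w n x - v' x)%R) +
      (2 * (K1 + K2 + 1)%:R)%:E * L1norm (window T K1 K2) (fun x => (w n x - v x)%R))%E) @ \oo --> 0%E.
    by rewrite -[0%E]adde0; apply: cvgeD => //; exact: cvg_mule0.
  apply: (ereal_le_vanishing h) => n; rewrite add0e.
  apply: le_trans (@excess_integral_lip R T f0 fT v (w n) K1 K2 j f0s fTs mvT (mw n _)) _.
  apply: leeD => //; apply: lee_wpmul2l; first by rewrite lee_fin mulr_ge0.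
  rewrite L1_distC; apply: L1norm_subset => //; exact: measurable_funB.
have mev := @measurable_excess R T f0 fT v K1 K2 j _ f0s fTs (measurable_itv _) mvT.
have : ae_eq (@lebesgue_measure R) `[(- T)%R, T]%classic
    (fun x => (excess T f0 fT K1 K2 j x (v x))%:E) (cst 0%E).
  apply/(ae_eq_integral_abs (@lebesgue_measure R) (measurable_itv `[(- T)%R, T])).
    exact/measurable_EFinP.
  rewrite -[RHS]ex0; apply: eq_integral => x _ /=.
  by rewrite ger0_norm// excess_ge0.
apply: filterS => x /= h xT; apply/excess0P => //.
by apply: EFin_inj; apply: h; rewrite in_itv.
Qed.

End OptimalInput.

(** * The optimal position among the levels *)

Section Bracket.
Variables (R : realType) (T : R) (f0 fT : R -> R) (K1 K2 : nat).
Hypotheses (T0 : 0 < T) (f0s : smooth f0) (fTs : smooth fT).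
Local Notation K := (K1 + K2 + 1)%N.
Local Notation A := (constA T f0 fT).

(** A continuous function with the right mean value that stays between the
    consecutive levels of index j. It need not be an input; it is the restriction
    to [-T, T] of an optimal L^1 function. *)
Definition admissible (j : nat) : Prop :=
  exists w0 P0 : R -> R, [/\ continuous w0, forall x, is_derive x (1 : R) P0 (w0 x),
    P0 T - P0 (- T) = A &
    forall x, - T <= x <= T -> between T f0 fT K1 K2 j x (w0 x)].

Lemma a_funE (i : nat) (x : R) : (i < K)%N ->
  a_fun T f0 fT K1 K2 i.+1 x = (level T f0 fT K1 K2 i x)%:E.
Proof. by move=> iK; rewrite /a_fun /= iK. Qed.

Lemma a_fun_oob (x : R) : a_fun T f0 fT K1 K2 K.+1 x = -oo%E.
Proof. by rewrite /a_fun /= ltnn. Qed.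

Lemma level_primitive (i : nat) :
  exists L : R -> R, forall x, is_derive x (1 : R) L (level T f0 fT K1 K2 i x).
Proof. by apply: continuous_primitive; exact: continuous_level. Qed.

Lemma a_intE (i : nat) (L : R -> R) : (i < K)%N ->
  (forall x, is_derive x (1 : R) L (level T f0 fT K1 K2 i x)) ->
  a_int T f0 fT K1 K2 i.+1 = (L T - L (- T))%:E.
Proof.
move=> iK dL; have TT : - T <= T by have := T0; lra.
have lc := @continuous_level R T f0 fT K1 K2 i f0s fTs.
rewrite -(integral_FTC2 TT lc dL) /a_int; apply: eq_integral => x _.
exact: a_funE.
Qed.

Lemma measure_TT : @lebesgue_measure R `[(- T)%R, T]%classic = (2 * T)%:E.
Proof.
rewrite lebesgue_measure_itv/= lte_fin ifT; last by have := T0; lra.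
by rewrite -EFinB; congr (_%:E); lra.
Qed.

Lemma a_int0 : a_int T f0 fT K1 K2 0 = +oo%E.
Proof.
rewrite /a_int (eq_integral (cst +oo%E)); last by move=> x _.
rewrite integral_cst//; set m := (X in (_ * X)%E).
have -> : m = (2 * T)%:E by exact: measure_TT.
by rewrite gt0_mulye// lte_fin mulr_gt0.
Qed.

Lemma a_int_oob : a_int T f0 fT K1 K2 K.+1 = -oo%E.
Proof.
rewrite /a_int (eq_integral (cst -oo%E)); last by move=> x _; exact: a_fun_oob.
rewrite integral_cst//; set m := (X in (_ * X)%E).
have -> : m = (2 * T)%:E by exact: measure_TT.
by rewrite gt0_mulNye// lte_fin mulr_gt0.
Qed.

Lemma a_int_anti (i j : nat) : (i <= j <= K.+1)%N ->
  (a_int T f0 fT K1 K2 j <= a_int T f0 fT K1 K2 i)%E.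
Proof.
move=> /andP[ij jK]; case: i ij => [|i] ij; first by rewrite a_int0 leey.
have [->|jK1] := eqVneq j K.+1; first by rewrite a_int_oob leNye.
case: j ij jK jK1 => [//|j] ij jK jK1; have {}jK : (j < K)%N by lia.
have iK : (i < K)%N by lia.
have [Li dLi] := level_primitive i; have [Lj dLj] := level_primitive j.
have TT : - T <= T by have := T0; lra.
have ci := @continuous_level R T f0 fT K1 K2 i f0s fTs.
have cj := @continuous_level R T f0 fT K1 K2 j f0s fTs.
rewrite (a_intE iK dLi) (a_intE jK dLj) -(integral_FTC2 TT ci dLi) -(integral_FTC2 TT cj dLj).
apply: le_integral => //; [exact: continuous_integrable_itv|exact: continuous_integrable_itv|].
by move=> x _; rewrite lee_fin; apply: level_anti; rewrite jK andbT.
Qed.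

(** A level is both above itself and below itself, so it is admissible for the
    two indices next to it. *)
Lemma admissible_level (i j : nat) : (i < K)%N -> j = i \/ j = i.+1 ->
  a_int T f0 fT K1 K2 i.+1 = A%:E -> admissible j.
Proof.
move=> iK ji; have [L dL] := level_primitive i; rewrite (a_intE iK dL) => -[LA].
exists (level T f0 fT K1 K2 i), L; split => //; first exact: continuous_level.
by move=> x _; exact: between_level.
Qed.

(** Above the highest level and below the lowest one, a level is translated by a
    constant. *)
Lemma admissible_shift (i j : nat) (c : R) (L : R -> R) : (i < K)%N ->
  (forall x, is_derive x (1 : R) L (level T f0 fT K1 K2 i x)) ->
  L T - L (- T) + 2 * T * c = A ->
  (j = 0%N /\ i = 0%N /\ 0 <= c) \/ (j = K /\ i.+1 = K /\ c <= 0) -> admissible j.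
Proof.
move=> iK dL LA hj; exists (fun x => level T f0 fT K1 K2 i x + c), (fun x => L x + (0 + c * x)); split.
- by move=> x; apply: cvgD; [exact: continuous_level|exact: cvg_cst].
- by move=> x; apply: is_derive_addf => //; exact: is_derive_affine.
- lra.
- move=> x _; case: hj => [[-> [i0 c0]]|[-> [iK1 c0]]]; split=> k.
  + by [].
  + move=> /andP[_ kK]; have := @level_anti R T f0 fT K1 K2 i k x; rewrite i0 kK => /(_ isT); lra.
  + move=> kK; have := @level_anti R T f0 fT K1 K2 k i x; rewrite iK andbT -ltnS iK1 kK => /(_ isT); lra.
  + by move=> /andP[]; lia.
Qed.

(** Between two consecutive levels, the convex combination with constant
    coefficients that has the right mean value is admissible. *)
Lemma admissible_bracket (j : nat) : is_bracket T f0 fT K1 K2 j -> admissible j.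
Proof.
have Tp := T0; move=> [jK /andP[]].
have [-> h1 _|j0] := eqVneq j 0%N.
  have K0 : (0 < K)%N by lia.
  have [L dL] := level_primitive 0; move: h1; rewrite (a_intE K0 dL) lte_fin => h1.
  apply: (admissible_shift (c := (A - (L T - L (- T))) / (2 * T)) K0 dL); first by field; lra.
  by left; do !split => //; rewrite divr_ge0//; lra.
case: j j0 jK => [//|i] _ iK; have [L dL] := level_primitive i.
rewrite [X in (_ -> (_ < X)%E -> _)](a_intE iK dL).
have [iK1 _ h2|iK1] := eqVneq i.+1 K.
  move: h2; rewrite lte_fin => h2.
  apply: (admissible_shift (c := (A - (L T - L (- T))) / (2 * T)) iK dL); first by field; lra.
  right; do !split => //; rewrite -oppr_ge0 -mulNr divr_ge0//; lra.
have iK2 : (i.+1 < K)%N by lia.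
have [L' dL'] := level_primitive i.+1; rewrite (a_intE iK2 dL') !lte_fin => h1 h2.
pose I := L T - L (- T); pose I' := L' T - L' (- T).
(* The weight of level i that gives the combination the integral A. *)
pose th := (A - I') / (I - I').
have th0 : 0 <= th by rewrite divr_ge0//; rewrite /I /I'; lra.
have th1 : th <= 1 by rewrite ler_pdivrMr /I /I'; lra.
have lc k := @continuous_level R T f0 fT K1 K2 k f0s fTs.
pose l := level T f0 fT K1 K2.
exists (fun x => l i.+1 x + th * (l i x - l i.+1 x)), (fun x => L' x + th * (L x - L' x)); split.
- move=> x; apply: cvgD; first exact: lc.
  by apply: cvgM; [exact: cvg_cst|apply: cvgB; exact: lc].
- move=> x; have h := is_derive_mulcf th (is_derive_subf (dL x) (dL' x)).
  exact: is_derive_addf (dL' x) h.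
- have : th * (I - I') = A - I' by rewrite /th mulfVK// subr_eq0 gt_eqF// /I /I'; lra.
  rewrite /I /I'; lra.
- move=> x _; have h12 : l i.+1 x <= l i x by apply: level_anti; rewrite leqnSn.
  have p1 : 0 <= th * (l i x - l i.+1 x) by rewrite mulr_ge0// subr_ge0.
  have p2 : th * (l i x - l i.+1 x) <= l i x - l i.+1 x by rewrite ler_piMl// subr_ge0.
  split=> k.
  + rewrite ltnS => ki; apply: (@le_trans _ _ (l i x)); first lra.
    by apply: level_anti; rewrite ki.
  + move=> /andP[ik kK]; apply: (@le_trans _ _ (l i.+1 x)); last lra.
    by apply: level_anti; rewrite ik.
Qed.

(** The least j for which a_(j+1) has integral smaller than A. *)
Lemma bracket_exists :
  (forall j, (1 <= j <= K)%N -> a_int T f0 fT K1 K2 j <> A%:E) ->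
  exists j, is_bracket T f0 fT K1 K2 j.
Proof.
move=> ne; have ex : exists j, (a_int T f0 fT K1 K2 j.+1 < A%:E)%E.
  by exists K; rewrite a_int_oob ltNyr.
have jK : (ex_minn ex <= K)%N by case: ex_minnP => j _; apply; rewrite a_int_oob ltNyr.
exists (ex_minn ex); split => //; move: jK; case: ex_minnP => j hj minj jK; rewrite hj /=.
case: j hj minj jK => [|j] hj minj jK; first by rewrite a_int0 ltry.
rewrite lt_neqAle leNgt; apply/andP; split.
  by apply/eqP => h; apply: (ne j.+1); rewrite ?jK.
by apply/negP => /minj; rewrite ltnn.
Qed.

Lemma bracket_unique (i j : nat) :
  is_bracket T f0 fT K1 K2 i -> is_bracket T f0 fT K1 K2 j -> i = j.
Proof.
have H i' j' : (i' < j')%N -> is_bracket T f0 fT K1 K2 i' -> is_bracket T f0 fT K1 K2 j' -> False.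
  move=> ij [iK /andP[h1 _]] [jK /andP[_ h2]].
  have h3 : (a_int T f0 fT K1 K2 j' <= a_int T f0 fT K1 K2 i'.+1)%E.
    by apply: a_int_anti; rewrite ij (leq_trans jK).
  by have := lt_trans (lt_le_trans h2 h3) h1; rewrite ltxx.
by move=> bi bj; have [ij|ji|//] := ltngtP i j; [case: (H i j)|case: (H j i)].
Qed.

Lemma admissible_pms (j : nat) : (j <= K)%N -> admissible j -> exists u, is_PMS T f0 fT K1 K2 u.
Proof. by move=> jK [w0 [P0 [w0c dP0 P0A bet]]]; exact: (pms_exists T0 f0s fTs jK w0c dP0 P0A bet). Qed.

Lemma admissible_between (j : nat) (u : nat -> R -> R -> R) (v : R -> R) :
  (j <= K)%N -> admissible j -> is_PMS T f0 fT K1 K2 u ->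
  L1_cvg (window T K1 K2) (fun n => input T (u n)) v ->
  {ae @lebesgue_measure R, forall x, - T <= x <= T -> between T f0 fT K1 K2 j x (v x)}.
Proof. by move=> jK [w0 [P0 [w0c dP0 P0A bet]]]; exact: (pms_limit_between T0 f0s fTs jK w0c dP0 P0A bet). Qed.

End Bracket.

Theorem mainTheorem6 (R : realType) (T : R) (f0 fT : R -> R) (K1 K2 : nat)
    (T_gt0 : 0 < T) (f0_smooth : smooth f0) (fT_smooth : smooth fT)
    (K1_ge1 : (1 <= K1)%N) (K2_ge1 : (1 <= K2)%N) :
  (exists u : nat -> R -> R -> R, is_PMS T f0 fT K1 K2 u) /\
  (forall (u : nat -> R -> R -> R) (v : R -> R),
    is_PMS T f0 fT K1 K2 u ->
    L1_cvg (window T K1 K2) (fun n => input T (u n)) v ->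
    (forall j : nat, (1 <= j <= K1 + K2 + 1)%N ->
      a_int T f0 fT K1 K2 j = (constA T f0 fT)%:E ->
      {ae @lebesgue_measure R, forall x, - T <= x <= T ->
        (v x)%:E = a_fun T f0 fT K1 K2 j x}) /\
    ((forall j : nat, (1 <= j <= K1 + K2 + 1)%N ->
        a_int T f0 fT K1 K2 j <> (constA T f0 fT)%:E) ->
      (exists! j : nat, is_bracket T f0 fT K1 K2 j) /\
      (forall j : nat, is_bracket T f0 fT K1 K2 j ->
        {ae @lebesgue_measure R, forall x, - T <= x <= T ->
          (a_fun T f0 fT K1 K2 j.+1 x <= (v x)%:E <=
             a_fun T f0 fT K1 K2 j x)%E}))).
Proof.
split.
  have [[j [jK je]]|ne] := pselect (exists j, (1 <= j <= K1 + K2 + 1)%N /\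
      a_int T f0 fT K1 K2 j = (constA T f0 fT)%:E).
    case: j jK je => [//|i] iK ie.
    have adm := admissible_level T_gt0 f0_smooth fT_smooth iK (or_intror erefl) ie.
    exact: admissible_pms adm.
  have [|j bj] := @bracket_exists R T f0 fT K1 K2 T_gt0.
    by move=> j jK je; apply: ne; exists j.
  exact: admissible_pms (bj.1) (admissible_bracket T_gt0 f0_smooth fT_smooth bj).
move=> u v pu cv; split.
  case=> [//|i] iK ie.
  have admL := admissible_level T_gt0 f0_smooth fT_smooth iK (or_introl erefl) ie.
  have admR := admissible_level T_gt0 f0_smooth fT_smooth iK (or_intror erefl) ie.
  have bL := admissible_between T_gt0 f0_smooth fT_smooth (ltnW iK) admL pu cv.
  have bR := admissible_between T_gt0 f0_smooth fT_smooth iK admR pu cv.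
  move: bL bR; apply: (@filterS2 _ _ (ae_filter_ringOfSetsType (@lebesgue_measure R))) => x bL bR xT; rewrite a_funE//; congr (_%:E).
  have [_ h1] := bL xT; have [h2 _] := bR xT.
  by apply/eqP; rewrite eq_le h2// h1// leqnn.
move=> ne; have [j bj] := bracket_exists T_gt0 ne; split.
  exists j; split => // j' bj'; exact: bracket_unique bj bj'.
move=> {bj}j bj; have jK := bj.1.
have := admissible_between T_gt0 f0_smooth fT_smooth jK (admissible_bracket T_gt0 f0_smooth fT_smooth bj) pu cv.
apply: (@filterS _ _ (ae_filter_ringOfSetsType (@lebesgue_measure R))) => x b xT; have [h1 h2] := b xT; apply/andP; split.
- have [->|jK1] := eqVneq j (K1 + K2 + 1)%N; first by rewrite a_fun_oob leNye.
  have {}jK1 : (j < K1 + K2 + 1)%N by rewrite ltn_neqAle jK1.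
  by rewrite a_funE// lee_fin; apply: h2; rewrite leqnn.
- case: j bj jK h1 {h2 b} => [|i] bj jK h1; first by rewrite leey.
  by rewrite a_funE// lee_fin; exact: h1.
Qed.
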